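(* Let $\mathcal{Y}=\{1,\dots,k\}$, let $L\in\mathbb{R}^{k\times k}$ be a nonnegative task loss matrix, let $F\in\mathbb{R}^{k\times r}$ and $\mathcal{F}=\{F\theta:\theta\in\mathbb{R}^r\}$. Let $K$ be a positive definite kernel on an input space $\mathcal{X}$ with RKHS $\mathcal{H}$ and feature map $\psi:\mathcal{X}\to\mathcal{H}$, and consider score functions $f_W(x)=FW\psi(x)$ where $W:\mathcal{H}\to\mathbb{R}^r$ is a linear operator with finite Hilbert–Schmidt norm $\|W\|_{HS}$. Let $\Phi:\mathbb{R}^k\times\mathcal{Y}\to\mathbb{R}$ be a continuous surrogate loss such that for every $y$, $f\mapsto\Phi(f,y)$ is convex and bounded from below. Let $\mathcal{D}$ be a distribution on $\mathcal{X}\times\mathcal{Y}$ such that $\mathcal{R}^*_{\Phi,\mathcal{F}}=\inf_{f\in\mathcal{F}_{\mathcal{F}}}\mathcal{R}_\Phi(f)$ is attained at some $f^*=f_{W^*}$ with $\|W^*\|_{HS}\le D$. Assume that $\mathbb{E}_{(x,y)\sim\mathcal{D}}\|F^\top g(x,y)\,\psi(x)^\top\|_{HS}^2\le M^2$ for every $W$ with $\|W\|_{HS}\le D$, where $g(x,y)\in\mathbb{R}^k$ is the (sub)gradient of $\Phi(\cdot,y)$ used by the algorithm at $f=f_W(x)$. Let $\check H$ be a convex non-decreasing lower bound of the calibration function $H_{\Phi,L,\mathcal{F}}$. Run ASGD for $N$ steps: with i.i.d. samples $(x^{(t)},y^{(t)})\sim\mathcal{D}$, $W^{(0)}=0$ and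 $$W^{(t)}=\mathrm{Proj}_D\bigl[W^{(t-1)}-\gamma F^\top g(x^{(t)},y^{(t)})\psi(x^{(t)})^\top\bigr],\quad \gamma=\frac{2D}{M\sqrt N},$$ where $g$ is evaluated at $W=W^{(t-1)}$ and $\mathrm{Proj}_D$ is the projection onto the Hilbert–Schmidt ball of radius $D$, and output $\bar f^{(N)}(x)=F\bar W\psi(x)$ with $\bar W=\frac1N\sum_{t=1}^N W^{(t)}$. Then for any $\varepsilon>0$, if $$N>N^*:=\frac{4D^2M^2}{\check H^2(\varepsilon)},$$ the (random) output satisfies $\mathbb{E}[\mathcal{R}_L(\bar f^{(N)})]<\mathcal{R}^*_{L,\mathcal{F}}+\varepsilon$, the expectation being over the training samples.
   Context: $\mathrm{pred}(f)$ is the smallest index maximizing $f_c$. For $q\in\Delta_k$: $\ell(f,q)=\sum_c q_cL(\mathrm{pred}(f),c)$, $\phi(f,q)=\sum_c q_c\Phi(f,c)$, $\delta\ell(f,q)=\ell(f,q)-\inf_{\hat f\in\mathcal{F}}\ell(\hat f,q)$, $\delta\phi(f,q)=\phi(f,q)-\inf_{\hat f\in\mathcal{F}}\phi(\hat f,q)$. Calibration function: $H_{\Phi,L,\mathcal{F}}(\varepsilon)=\inf\{\delta\phi(f,q):f\in\mathcal{F},q\in\Delta_k,\delta\ell(f,q)\ge\varepsilon\}$ ($+\infty$ if empty). $\mathcal{F}_{\mathcal{F}}$ is the set of Borel measurable functions $\mathcal{X}\to\mathcal{F}$; $\mathcal{R}_L(f)=\mathbb{E}_{\mathcal{D}}L(\mathrm{pred}(f(x)),y)$,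 $\mathcal{R}_\Phi(f)=\mathbb{E}_{\mathcal{D}}\Phi(f(x),y)$, $\mathcal{R}^*_{L,\mathcal{F}}=\inf_{f\in\mathcal{F}_{\mathcal{F}}}\mathcal{R}_L(f)$. The Hilbert–Schmidt norm of $A$ is $\sqrt{\mathrm{tr}(A^*A)}$.
   Formalization: The lower bound Ȟ is taken real-valued and nonnegative on [0,∞) (with negative Ȟ(ε) the claim fails, e.g. Ȟ a large negative constant); M>0 and measurability of the kernel, feature map and subgradient selection g(f,y) are assumed so that γ and the expectations are defined. *)

(* Defs.v *)
From HB Require Import structures.
From mathcomp Require Import all_boot all_order all_algebra.
From mathcomp Require Import all_classical all_reals all_analysis.
Set Implicit Arguments. Unset Strict Implicit. Unset Printing Implicit Defensive.
Import Order.TTheory GRing.Theory Num.Theory.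
Import numFieldNormedType.Exports.
Local Open Scope classical_set_scope.
Local Open Scope ring_scope.

HB.instance Definition _ (n : nat) := isPointed.Build 'I_n.+1 ord0.
HB.instance Definition _ (n : nat) := @isMeasurable.Build default_measure_display
  'I_n.+1 discrete_measurable discrete_measurable0
  discrete_measurableC discrete_measurableU.

Section Defs.
Variable R : realType.

Definition pred_score (k : nat) (f : 'cV[R]_k.+1) : 'I_k.+1 :=
  let m := [arg max_(i > ord0) f i 0]%O in
  [arg min_(i < m | [forall j, f j 0 <= f i 0]) (i : nat)].

Definition simplex (k : nat) : set ('cV[R]_k.+1) :=
  [set q | (forall c, 0 <= q c 0) /\ \sum_c q c 0 = 1].

Definition score_set (k r : nat) (F : 'M[R]_(k.+1, r)) : set ('cV[R]_k.+1) :=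
  [set F *m theta | theta in [set: 'cV[R]_r]].

Definition cond_task_loss (k : nat) (L : 'M[R]_k.+1) (f q : 'cV[R]_k.+1) : R :=
  \sum_c q c 0 * L (pred_score f) c.

Definition cond_surr_loss (k : nat) (Phi : 'cV[R]_k.+1 -> 'I_k.+1 -> R)
  (f q : 'cV[R]_k.+1) : R :=
  \sum_c q c 0 * Phi f c.

Definition excess_task (k r : nat) (L : 'M[R]_k.+1) (F : 'M[R]_(k.+1, r))
  (f q : 'cV[R]_k.+1) : \bar R :=
  ((cond_task_loss L f q)%:E -
   ereal_inf [set (cond_task_loss L fh q)%:E | fh in score_set F])%E.

Definition excess_surr (k r : nat) (Phi : 'cV[R]_k.+1 -> 'I_k.+1 -> R)
  (F : 'M[R]_(k.+1, r)) (f q : 'cV[R]_k.+1) : \bar R :=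
  ((cond_surr_loss Phi f q)%:E -
   ereal_inf [set (cond_surr_loss Phi fh q)%:E | fh in score_set F])%E.

(* calibration function H_{Phi,L,F}(eps); ereal_inf set0 = +oo *)
Definition calibration_fun (k r : nat) (Phi : 'cV[R]_k.+1 -> 'I_k.+1 -> R)
  (L : 'M[R]_k.+1) (F : 'M[R]_(k.+1, r)) (eps : R) : \bar R :=
  ereal_inf [set e | exists f q, [/\ score_set F f, simplex q,
     (eps%:E <= excess_task L F f q)%E & e = excess_surr Phi F f q]].

Definition inner_product (V : normedModType R) (ip : V -> V -> R) : Prop :=
  [/\ forall u v, ip u v = ip v u,
      forall (a : R) u v w, ip (a *: u + v) w = a * ip u w + ip v w
    & forall v, ip v v = `|v| ^+ 2].

Definition dense_span (T : Type) (V : normedModType R) (psi : T -> V) : Prop :=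
  forall (v : V) (e : R), 0 < e -> exists (n : nat) (c : 'I_n -> R) (xs : 'I_n -> T),
    `|v - \sum_i c i *: psi (xs i)| < e.

(* A Hilbert–Schmidt operator W : V -> R^r is represented by the r vectors
   w_j of V (rows, via Riesz): W h = (<w_j, h>)_j, ||W||_HS^2 = sum_j ||w_j||^2 *)
Definition hs_norm (V : normedModType R) (r : nat) (w : 'I_r -> V) : R :=
  Num.sqrt (\sum_j `|w j| ^+ 2).

Definition apply_op (V : normedModType R) (ip : V -> V -> R) (r : nat)
  (w : 'I_r -> V) (h : V) : 'cV[R]_r := \col_j ip (w j) h.

Definition proj_ball (V : normedModType R) (r : nat) (D : R) (w : 'I_r -> V)
  : 'I_r -> V :=
  if hs_norm w <= D then w else (fun j => (D / hs_norm w) *: w j).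

Context {d : measure_display} {X : measurableType d}.

Definition meas_score_funs (k r : nat) (F : 'M[R]_(k.+1, r)) :
  set (X -> 'cV[R]_k.+1) :=
  [set f | (forall x, score_set F (f x)) /\
           forall i, measurable_fun setT (fun x => f x i 0)].

Definition risk_L (k : nat) (P : probability (X * 'I_k.+1)%type R)
  (L : 'M[R]_k.+1) (f : X -> 'cV[R]_k.+1) : \bar R :=
  (\int[P]_z (L (pred_score (f z.1)) z.2)%:E)%E.

Definition risk_Phi (k : nat) (P : probability (X * 'I_k.+1)%type R)
  (Phi : 'cV[R]_k.+1 -> 'I_k.+1 -> R) (f : X -> 'cV[R]_k.+1) : \bar R :=
  (\int[P]_z (Phi (f z.1) z.2)%:E)%E.

Fixpoint iid_expect (T : measurableType d) (P : probability T R) (N : nat)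
  (G : seq T -> \bar R) : \bar R :=
  match N with
  | 0 => G [::]
  | N'.+1 => (\int[P]_z iid_expect P N' (fun s => G (z :: s)))%E
  end.

Definition asgd_step (k r : nat) (V : normedModType R) (ip : V -> V -> R)
  (psi : X -> V) (F : 'M[R]_(k.+1, r))
  (g : 'cV[R]_k.+1 -> 'I_k.+1 -> 'cV[R]_k.+1) (D gamma : R)
  (w : 'I_r -> V) (z : X * 'I_k.+1) : 'I_r -> V :=
  let gr := F^T *m g (F *m apply_op ip w (psi z.1)) z.2 in
  proj_ball D (fun j => w j - (gamma * gr j 0) *: psi z.1).

Definition asgd_iterate (k r : nat) (V : normedModType R) (ip : V -> V -> R)
  (psi : X -> V) (F : 'M[R]_(k.+1, r))
  (g : 'cV[R]_k.+1 -> 'I_k.+1 -> 'cV[R]_k.+1) (D gamma : R)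
  (s : seq (X * 'I_k.+1)) (t : nat) : 'I_r -> V :=
  foldl (asgd_step ip psi F g D gamma) (fun _ => 0) (take t s).

Definition asgd_average (k r : nat) (V : normedModType R) (ip : V -> V -> R)
  (psi : X -> V) (F : 'M[R]_(k.+1, r))
  (g : 'cV[R]_k.+1 -> 'I_k.+1 -> 'cV[R]_k.+1) (D gamma : R) (N : nat)
  (s : seq (X * 'I_k.+1)) : 'I_r -> V :=
  fun j => (N%:R)^-1 *: \sum_(1 <= t < N.+1) asgd_iterate ip psi F g D gamma s t j.

End Defs.

(* Main.v *)
Require Import Defs.
From HB Require Import structures.
From mathcomp Require Import all_boot all_order all_algebra.
From mathcomp Require Import all_classical all_reals all_analysis.
From mathcomp Require Import measurable_realfun ring lra.
Set Implicit Arguments. Unset Strict Implicit. Unset Printing Implicit Defensive.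
Import Order.TTheory GRing.Theory Num.Theory.
Import numFieldNormedType.Exports.
Local Open Scope classical_set_scope.
Local Open Scope ring_scope.

(** Let a be the slope of a supporting line of Hc at eps. The calibration bound
    gives, pointwise in (f, q), a * (excess task loss) <= (excess surrogate loss)
    + a * eps - Hc eps. It integrates without conditional probabilities: cut X
    into countably many cells on which pred f, pred h and, up to eta, the
    surrogate losses of f are constant, take for q the average label distribution
    of the cell, and let u be a near-optimal constant score on each cell. Since
    R_Phi(u) is at least the optimal risk, the task excess is at most eps - Hc eps / a plus 1/a
    times the surrogate excess.

    For the surrogate excess, nonexpansiveness of the projection and the
    subgradient inequality give the usual one-step descent of ||W - W^*||^2. The
    iterates being averaged start at W^(1), whose squared distance to W^* is at
    most 4 D^2; the regret bound is then 2 D M / sqrt N < Hc eps. The iterated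
    expectation is bounded from the last sample backwards by monotonicity alone,
    so that joint measurability in the samples is never needed. *)

(** * Measurability *)

Section Measurability.
Context {d : measure_display} {X : measurableType d}.

(** Any preimage under [f] is a union of fibres of [key], hence a countable union of measurable
    sets. Functions of score vectors are handled by finding such a key. *)
Lemma measurable_fun_countable_factor (C : countType) d' (U : measurableType d')
    (key : X -> C) (f : X -> U) :
  (forall c, measurable (key @^-1` [set c])) ->
  (forall x x', key x = key x' -> f x = f x') -> measurable_fun setT f.
Proof.
move=> mkey kf _ B _; rewrite setTI.
have -> : f @^-1` B =
    \bigcup_(c : C) (if `[< exists2 x, key x = c & B (f x) >]
                     then key @^-1` [set c] else set0).
  apply/seteqP; split=> [x /= Bx|x [c _]].
    exists (key x) => //=; case: asboolP => //= -[]; by exists x.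
  by case: asboolP => //= -[x' <- Bx'] /kf ->.
apply: countable_bigcupT_measurable => [|c]; first exact: countableP.
by case: ifP.
Qed.

Lemma measurable_fiber_ffun (I : finType) (C : eqType) (key : X -> I -> C) :
  (forall i c, measurable [set x | key x i = c]) ->
  forall h : {ffun I -> C},
    measurable ((fun x => [ffun i => key x i]) @^-1` [set h]).
Proof.
move=> mkey h.
have -> : (fun x => [ffun i => key x i]) @^-1` [set h] =
    \bigcap_(i in [set: I]) [set x | key x i = h i].
  apply/seteqP; split=> x /= => [<- i _|kh]; first by rewrite /= ffunE.
  by apply/ffunP => i; rewrite ffunE; exact: kh.
apply: fin_bigcap_measurable => [|i _]; last exact: mkey.
exact: finite_finset.
Qed.

Lemma measurable_fiber_floor (R : realType) (f : X -> R) (m : int) :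
  measurable_fun setT f -> measurable [set x | Num.floor (f x) = m].
Proof.
move=> mf.
have -> : [set x | Num.floor (f x) = m] =
    f @^-1` [set` `[m%:~R, (m + 1)%:~R[%R].
  apply/seteqP; split=> x /=; rewrite in_itv /=.
    by move/eqP; rewrite floor_eq.
  by rewrite -floor_eq => /eqP.
by rewrite -[X in measurable X]setTI; exact: mf.
Qed.

(** There are finitely many labels, so a preimage is a finite union of measurable rectangles, one
    per label. *)
Lemma measurable_fun_label (k : nat) d' (U : measurableType d')
    (G : X * 'I_k.+1 -> U) :
  (forall c, measurable_fun setT (fun x => G (x, c))) -> measurable_fun setT G.
Proof.
move=> mG _ B mB; rewrite setTI.
have -> : G @^-1` B =
    \bigcup_(c in [set: 'I_k.+1]) ((fun x => G (x, c)) @^-1` B `*` [set c]).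
  apply/seteqP; split=> [[x c] /= BG|[x c] /= [_ _ [/= + ->]] //].
  by exists c.
apply: fin_bigcup_measurable => [|c _]; first exact: finite_finset.
by apply: measurableX => //; rewrite -[X in measurable X]setTI; exact: mG.
Qed.

Context {R : realType}.

Lemma measurable_fun_mulmx (m n : nat) (F : 'M[R]_(m, n)) (f : X -> 'cV[R]_n) :
  (forall i, measurable_fun setT (fun x => f x i 0)) ->
  forall i, measurable_fun setT (fun x => (F *m f x) i 0).
Proof.
move=> mf i; under eq_fun do rewrite mxE.
by apply: measurable_sum => j; exact: measurable_funM.
Qed.

(** Rounding the coordinates down to multiples of [1/(n+1)] makes the composite depend on a
    countable key; by continuity these approximations converge pointwise to [phi \o f]. *)
Lemma measurable_fun_continuous_score (k : nat) (phi : 'cV[R]_k.+1 -> R)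
    (f : X -> 'cV[R]_k.+1) :
  continuous phi -> (forall i, measurable_fun setT (fun x => f x i 0)) ->
  measurable_fun setT (phi \o f).
Proof.
move=> cphi mf.
pose rnd n (v : 'cV[R]_k.+1) : 'cV[R]_k.+1 :=
  \col_i ((Num.floor (n.+1%:R * v i 0))%:~R / n.+1%:R).
apply: (@measurable_fun_cvg _ _ _ _ (fun n x => phi (rnd n (f x)))) => [n|x _].
  apply: (@measurable_fun_countable_factor _ _ _
    (fun x => [ffun i => Num.floor (n.+1%:R * f x i 0)])).
    move=> h; apply: measurable_fiber_ffun => i c; apply: measurable_fiber_floor.
    exact: measurable_funM.
  move=> x x' /ffunP e; congr phi; apply/matrixP => i j; rewrite !mxE.
  by have := e i; rewrite !ffunE => ->.
suff r : rnd n (f x) @[n --> \oo] --> f x by exact: cvg_comp r (cphi (f x)).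
apply/cvg_ballP => e e0; near=> n; split=> // i j.
rewrite /ball /= (ord1 j) mxE.
have n0 : 0 < n.+1%:R :> R by [].
have /andP[l u] := floor_itv (n.+1%:R * f x i 0).
have e1 : 1 < e * n.+1%:R.
  rewrite -ltr_pdivrMr // mul1r.
  by near: n; exact: (near_infty_natSinv_lt (PosNum e0)).
set m := Num.floor _ in l u *.
have -> : f x i 0 - m%:~R / n.+1%:R = (n.+1%:R * f x i 0 - m%:~R) / n.+1%:R.
  by field; rewrite nat1r pnatr_eq0.
rewrite ger0_norm; last by rewrite divr_ge0 // subr_ge0.
rewrite ltr_pdivrMr //; apply: lt_trans e1.
by rewrite ltrBlDl addrC; move: u; rewrite intrD addrC.
Unshelve. all: by end_near. Qed.

Lemma pred_scoreP (k : nat) (f : 'cV[R]_k.+1) :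
  (forall j, f j 0 <= f (pred_score f) 0) /\
  (forall i, (forall j, f j 0 <= f i 0) -> (pred_score f <= i)%N).
Proof.
rewrite /pred_score.
case: (@Order.TotalTheory.arg_maxP _ _ _ ord0 xpredT (fun i => f i 0)) => // m _ hm.
case: arg_minnP => [|i /forallP hi hmin]; first by apply/forallP => j; exact: hm.
by split=> // i' hi'; apply: hmin; exact/forallP.
Qed.

(** The prediction is determined by the finite table of comparisons between coordinates, and each
    comparison is measurable. *)
Lemma measurable_fiber_pred_score (k : nat) (f : X -> 'cV[R]_k.+1) :
  (forall i, measurable_fun setT (fun x => f x i 0)) ->
  forall c, measurable [set x | pred_score (f x) = c].
Proof.
move=> mf c.
have : measurable_fun setT (fun x => pred_score (f x)).
  apply: (@measurable_fun_countable_factor _ _ _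
    (fun x => [ffun p : 'I_k.+1 * 'I_k.+1 => f x p.1 0 <= f x p.2 0])).
    move=> h; apply: (@measurable_fiber_ffun _ bool
      (fun x (p : 'I_k.+1 * 'I_k.+1) => f x p.1 0 <= f x p.2 0)) => -[i j] b /=.
    rewrite -[X in measurable X]setTI.
    by have /(_ measurableT [set b]) := measurable_fun_ler (mf i) (mf j); apply.
  (* With equal tables, each prediction is also a maximizer for the other score; minimality of the
     index gives one inequality, and exchanging the points gives the other. *)
  have half x x' : [ffun p : 'I_k.+1 * 'I_k.+1 => f x p.1 0 <= f x p.2 0] =
      [ffun p : 'I_k.+1 * 'I_k.+1 => f x' p.1 0 <= f x' p.2 0] ->
      (pred_score (f x) <= pred_score (f x'))%N.
    move=> /ffunP e; apply: (pred_scoreP (f x)).2 => j.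
    have := e (j, pred_score (f x')); rewrite !ffunE /= => ->.
    exact: (pred_scoreP (f x')).1.
  move=> x x' e; apply/val_inj/eqP; rewrite /= eqn_leq.
  by rewrite half //= half.
by move=> mp; rewrite -[X in measurable X]setTI; exact: (mp _ [set c]).
Qed.

Lemma measurable_fun_task_loss (k : nat) (L : 'M[R]_k.+1) (f : X -> 'cV[R]_k.+1) :
  (forall i, measurable_fun setT (fun x => f x i 0)) ->
  measurable_fun setT (fun z : X * 'I_k.+1 => L (pred_score (f z.1)) z.2).
Proof.
move=> mf; apply: measurable_fun_label => c /=.
apply: (@measurable_fun_countable_factor _ _ _ (fun x => pred_score (f x))).
  exact: measurable_fiber_pred_score.
by move=> x x' ->.
Qed.

Lemma measurable_fun_surr_loss (k : nat) (Phi : 'cV[R]_k.+1 -> 'I_k.+1 -> R)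
    (f : X -> 'cV[R]_k.+1) :
  (forall y, continuous (fun f => Phi f y)) ->
  (forall i, measurable_fun setT (fun x => f x i 0)) ->
  measurable_fun setT (fun z : X * 'I_k.+1 => Phi (f z.1) z.2).
Proof.
move=> cPhi mf; apply: measurable_fun_label => c /=.
exact: (measurable_fun_continuous_score (cPhi c)).
Qed.

End Measurability.

(** * Supporting lines and calibration *)

(** Replaces the extended-real infima of the definitions by real numbers that come with
    near-minimizers. *)
Lemma ereal_inf_image (R : realType) (T : Type) (S : set T) (g : T -> R) (b : R) :
  S !=set0 -> (forall x, S x -> b <= g x) ->
  exists m : R, [/\ ereal_inf [set (g x)%:E | x in S] = m%:E,
    forall x, S x -> m <= g x &
    forall e, 0 < e -> exists2 x, S x & g x < m + e].
Proof.
move=> [x0 Sx0] gb.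
have S0 : (g @` S) !=set0 by exists (g x0), x0.
have lbS : has_lbound (g @` S) by exists b => _ [x Sx <-]; exact: gb.
exists (inf (g @` S)); split=> [|x Sx|e e0].
- rewrite -ereal_inf_EFin //; congr ereal_inf; apply/seteqP.
  split=> [_ [x Sx <-]|_ [_ [x Sx <-] <-]]; last by exists x.
  by exists (g x) => //; exists x.
- by apply: ge_inf => //; exists x.
- have [_ [x Sx <-] gx] := inf_adherent e0 (conj S0 lbS).
  by exists x.
Qed.

(** The slope [a] is the supremum of the chord slopes to the left of [eps]. Convexity bounds them by
    every chord slope to the right, and monotonicity makes the slope from [0] nonnegative. *)
Lemma convex_nondecreasing_support (R : realType) (H : R -> R) (eps : R) :
  0 < eps ->
  (forall e1 e2, 0 <= e1 -> e1 <= e2 -> H e1 <= H e2) ->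
  (forall e1 e2 (t : R), 0 <= e1 -> 0 <= e2 -> 0 <= t <= 1 ->
     H (t * e1 + (1 - t) * e2) <= t * H e1 + (1 - t) * H e2) ->
  exists2 a, 0 <= a & forall e, 0 <= e -> H eps + a * (e - eps) <= H e.
Proof.
move=> eps0 Hmono Hconv.
pose slope e := (H eps - H e) / (eps - e).
pose S := [set slope e | e in [set e | 0 <= e < eps]].
have slopes e e' : 0 <= e < eps -> eps < e' ->
    slope e <= (H e' - H eps) / (e' - eps).
  move=> /andP[e0 ee] ee'.
  have d1 : 0 < eps - e by rewrite subr_gt0.
  have d2 : 0 < e' - eps by rewrite subr_gt0.
  have d3 : 0 < e' - e by rewrite subr_gt0 (lt_trans ee).
  (* The weight that writes [eps] as a convex combination of [e] and [e']. *)
  pose t := (e' - eps) / (e' - e).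
  have t01 : 0 <= t <= 1.
    rewrite /t divr_ge0 ?(ltW d2) ?(ltW d3) //= ler_pdivrMr // mul1r.
    by rewrite lerD2l lerN2 ltW.
  have e'0 : 0 <= e' by apply: ltW; apply: lt_trans ee'.
  have := Hconv e e' t e0 e'0 t01.
  have -> : t * e + (1 - t) * e' = eps by rewrite /t; field; rewrite gt_eqF.
  move=> h; rewrite /slope ler_pdivrMr // mulrAC ler_pdivlMr //.
  have /(ler_wpM2r (ltW d3)) : H eps - t * H e - (1 - t) * H e' <= 0 by lra.
  have -> : (H eps - t * H e - (1 - t) * H e') * (e' - e) =
     H eps * (e' - e) - (e' - eps) * H e - (eps - e) * H e'.
    by rewrite /t; field; rewrite gt_eqF.
  by nra.
have S0 : S !=set0 by exists (slope 0), 0 => //=; rewrite lexx eps0.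
have ubS : has_ubound S.
  exists ((H (eps + 1) - H eps) / (eps + 1 - eps)) => _ [e he <-].
  by apply: slopes => //; rewrite ltrDl.
exists (sup S) => [|e e0].
  apply: (@le_trans _ _ (slope 0)).
    by rewrite /slope subr0 divr_ge0 ?(ltW eps0) // subr_ge0 Hmono // ltW.
  by apply: ub_le_sup => //; exists 0 => //=; rewrite lexx eps0.
have [ee|ee|<-] := ltgtP e eps; last by rewrite subrr mulr0 addr0.
- have : slope e <= sup S by apply: ub_le_sup => //; exists e => //=; rewrite e0.
  by rewrite /slope ler_pdivrMr ?subr_gt0 //; lra.
- have : sup S <= (H e - H eps) / (e - eps).
    by apply: ge_sup => // _ [e1 he1 <-]; exact: slopes.
  by rewrite ler_pdivlMr ?subr_gt0 //; lra.
Qed.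

Section Calibration.
Context {R : realType} {k r : nat}.
Variables (L : 'M[R]_k.+1) (F : 'M[R]_(k.+1, r)).
Variables (Phi : 'cV[R]_k.+1 -> 'I_k.+1 -> R) (Hc : R -> R) (eps a B : R).
Hypothesis L0 : forall i j, 0 <= L i j.
Hypothesis PhiB : forall f y, B <= Phi f y.
Hypothesis a0 : 0 <= a.
Hypothesis Hc_supp : forall e, 0 <= e -> Hc eps + a * (e - eps) <= Hc e.
Hypothesis Hc_lb : forall e, 0 <= e -> ((Hc e)%:E <= calibration_fun Phi L F e)%E.

Lemma score_set0 : score_set F 0.
Proof. by exists 0 => //; rewrite mulmx0. Qed.

(** The supporting line is evaluated at the task excess of [f] under [q], where [Hc] is at most the
    surrogate excess. The score [u] nearly minimizes the conditional surrogate loss, and [h] does no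
    better than the best task loss. *)
Lemma calibration_improve (f h q : 'cV[R]_k.+1) (eta : R) :
  score_set F f -> score_set F h -> simplex q -> 0 < eta ->
  exists2 u, score_set F u &
    a * cond_task_loss L f q + Hc eps + cond_surr_loss Phi u q <=
    cond_surr_loss Phi f q + a * cond_task_loss L h q + a * eps + eta.
Proof.
move=> Ff Fh sq eta0; have [q0 q1] := sq.
have F0 : score_set F !=set0 by exists 0; exact: score_set0.
have [||ml [ml_eq mlb _]] := @ereal_inf_image _ _ (score_set F)
    (fun fh => cond_task_loss L fh q) 0 => //.
  by move=> x _; apply: sumr_ge0 => c _; rewrite mulr_ge0.
have [||ms [ms_eq _ msa]] := @ereal_inf_image _ _ (score_set F)
    (fun fh => cond_surr_loss Phi fh q) B => //.
  move=> x _; rewrite -[B]mul1r -q1 mulr_suml.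
  by apply: ler_sum => c _; exact: ler_wpM2l.
have e0 : 0 <= cond_task_loss L f q - ml by rewrite subr_ge0 mlb.
have : Hc (cond_task_loss L f q - ml) <= cond_surr_loss Phi f q - ms.
  rewrite -lee_fin; apply: le_trans (Hc_lb e0) _.
  apply: ereal_inf_lbound; exists f, q; split=> //.
    by rewrite /excess_task ml_eq.
  by rewrite /excess_surr ms_eq.
have [u Fu um] := msa _ eta0 => hc; exists u => //.
have := Hc_supp e0; have := ler_wpM2l a0 (mlb _ Fh).
by rewrite !mulrBr; lra.
Qed.

End Calibration.

(** * Averaging over countably many cells *)

Section NonnegativeIntegrals.
Context {d : measure_display} {T : measurableType d} {R : realType}.
Variable mu : {measure set T -> \bar R}.
Local Open Scope ereal_scope.

(* Unlike [ge0_le_integral], this requires no measurability: the integral of a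
   nonnegative function is a supremum over the simple functions below it. *)
Lemma ge0_le_integral_nonmeasurable (f1 f2 : T -> \bar R) :
  (forall x, 0 <= f1 x) -> (forall x, f1 x <= f2 x) ->
  \int[mu]_x f1 x <= \int[mu]_x f2 x.
Proof.
move=> f10 f12.
rewrite !ge0_integralTE => [|x|//]; last exact: le_trans (f12 x).
apply: ereal_sup_le => _ [h /= hf <-]; exists h => // x.
exact: le_trans (f12 x).
Qed.

Lemma ge0_le_integral_fibers (key : T -> nat) (f1 f2 : T -> \bar R) :
  measurable_fun setT key ->
  measurable_fun setT f1 -> measurable_fun setT f2 ->
  (forall x, 0 <= f1 x) -> (forall x, 0 <= f2 x) ->
  (forall n, \int[mu]_(x in key @^-1` [set n]) f1 x <=
             \int[mu]_(x in key @^-1` [set n]) f2 x) ->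
  \int[mu]_x f1 x <= \int[mu]_x f2 x.
Proof.
move=> mkey mf1 mf2 f10 f20 f12.
have fibE : \bigcup_n (key @^-1` [set n]) = [set: T].
  by apply/seteqP; split=> // x _; exists (key x).
have mfib n : measurable (key @^-1` [set n]).
  by rewrite -[X in measurable X]setTI; exact: (mkey measurableT [set n]).
have tfib : trivIset setT (fun n => key @^-1` [set n]).
  by move=> i j _ _ [x [/= <- <-]].
rewrite -fibE !ge0_integral_bigcup // ?fibE //.
apply: lee_nneseries => [n _ _|n _]; last exact: f12.
exact: integral_ge0.
Qed.

End NonnegativeIntegrals.

Section Cells.
Context {d : measure_display} {X : measurableType d} {R : realType} {k : nat}.
Variable P : probability (X * 'I_k.+1)%type R.

(** The unnormalized label distribution of the cell; dividing by its total mass gives the point of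
    the simplex used for calibration. *)
Definition cell_weight (A : set X) (c : 'I_k.+1) : R := fine (P (A `*` [set c])).

Lemma cell_weight_ge0 A c : 0 <= cell_weight A c.
Proof. exact/fine_ge0/measure_ge0. Qed.

Lemma integral_label_cell (A : set X) (G : 'I_k.+1 -> R) :
  measurable A -> (forall c, 0 <= G c) ->
  (\int[P]_(z in A `*` setT) (G z.2)%:E = (\sum_c cell_weight A c * G c)%:E)%E.
Proof.
move=> mA G0.
have mc c : measurable (setT `*` [set c] : set (X * 'I_k.+1)) by exact: measurableX.
have mAT : measurable (A `*` setT : set (X * 'I_k.+1)) by exact: measurableX.
have ind0 c z : (0 <= (\1_(setT `*` [set c]) z : R)%:E)%E.
  by rewrite lee_fin indicE ler0n.
transitivity (\int[P]_(z in A `*` setT)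
    \sum_c ((G c)%:E * (\1_(setT `*` [set c]) z)%:E))%E.
  apply: eq_integral => -[x y] _ /=.
  rewrite (bigD1 y) //= big1 ?adde0 => [|c cy].
    by rewrite indicE mem_set ?mule1.
  rewrite indicE memNset ?mule0 // => -[_ /= yc].
  by move: cy; rewrite yc eqxx.
rewrite ge0_integral_sum //; last 2 first.
- move=> c; apply: measurable_funeM; apply/measurable_EFinP.
  exact: measurable_indic.
- by move=> c z _; apply: mule_ge0; rewrite ?lee_fin.
rewrite -sumEFin; apply: eq_bigr => c _.
rewrite ge0_integralZl ?lee_fin //; last first.
  by apply/measurable_EFinP; exact: measurable_indic.
rewrite integral_indic // setIC -setXI setIT setTI muleC EFinM.
by congr (_ * _)%E; rewrite fineK // fin_num_measure //; exact: measurableX.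
Qed.

End Cells.

Section Averaging.
Context {d : measure_display} {X : measurableType d} {R : realType} {k r : nat}.
Variable P : probability (X * 'I_k.+1)%type R.
Variables (L : 'M[R]_k.+1) (F : 'M[R]_(k.+1, r)).
Variables (Phi : 'cV[R]_k.+1 -> 'I_k.+1 -> R) (Hc : R -> R) (eps a B : R).
Hypothesis L0 : forall i j, 0 <= L i j.
Hypothesis Phi_cont : forall y, continuous (fun f => Phi f y).
Hypothesis PhiB : forall f y, B <= Phi f y.
Hypothesis eps0 : 0 < eps.
Hypothesis a0 : 0 <= a.
Hypothesis Hc_eps : 0 <= Hc eps.
Hypothesis Hc_supp : forall e, 0 <= e -> Hc eps + a * (e - eps) <= Hc e.
Hypothesis Hc_lb : forall e, 0 <= e -> ((Hc e)%:E <= calibration_fun Phi L F e)%E.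

(** [calibration_improve] at the normalized weights, multiplied back by their sum; the constants can
    enter the sums because the normalized weights add up to one. *)
Lemma weighted_improve (f h : 'cV[R]_k.+1) (m : 'I_k.+1 -> R) (eta : R) :
  score_set F f -> score_set F h -> (forall c, 0 <= m c) -> 0 < eta ->
  exists2 u, score_set F u &
    \sum_c m c * (a * L (pred_score f) c + Hc eps + Phi u c - B) <=
    \sum_c m c * (Phi f c + a * L (pred_score h) c + a * eps + eta - B).
Proof.
move=> Ff Fh m0 eta0.
have [s0|sN0] := eqVneq (\sum_c m c) 0.
  (* All weights vanish, so both sides are zero and any score will do. *)
  exists 0; first exact: score_set0.
  have mz c : m c = 0.
    move/eqP: s0; rewrite psumr_eq0 // => /allP /(_ c).
    by rewrite mem_index_enum => /(_ isT) /eqP.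
  by rewrite !big1 // => c _; rewrite mz mul0r.
have s_gt0 : 0 < \sum_c m c by rewrite lt_neqAle eq_sym sN0 sumr_ge0.
set s := \sum_c m c in sN0 s_gt0.
pose q : 'cV[R]_k.+1 := \col_c (m c / s).
have sq : simplex q.
  split=> [c|]; first by rewrite mxE divr_ge0 // ltW.
  by under eq_bigr do rewrite mxE; rewrite -mulr_suml mulfV.
have [u Fu hu] := calibration_improve L0 PhiB a0 Hc_supp Hc_lb Ff Fh sq eta0.
exists u => //.
have mE c : m c = s * q c 0 by rewrite mxE mulrC divfK.
have q1 := sq.2.
have affE (G1 G2 : 'I_k.+1 -> R) (t : R) :
    \sum_c q c 0 * (a * G1 c + G2 c + t) =
    a * (\sum_c q c 0 * G1 c) + \sum_c q c 0 * G2 c + t.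
  rewrite -[X in _ = _ + X]mul1r -q1 mulr_suml mulr_sumr -!big_split /=.
  by apply: eq_bigr => c _; ring.
rewrite (eq_bigr (fun c => s * (q c 0 *
  (a * L (pred_score f) c + Phi u c + (Hc eps - B))))); last first.
  by move=> c _; rewrite mE; ring.
rewrite [leRHS](eq_bigr (fun c => s * (q c 0 *
  (a * L (pred_score h) c + Phi f c + (a * eps + eta - B))))); last first.
  by move=> c _; rewrite mE; ring.
rewrite -!mulr_sumr ler_pM2l // !affE.
by move: hu; rewrite /cond_task_loss /cond_surr_loss; lra.
Qed.

(** The cells are the fibres of a countable key recording both predictions and the rounded surrogate
    losses of [f]. Subtracting [B] keeps both integrands nonnegative, so the integrals split over
    the cells before integrability is known. One [eta] pays for the near-optimality of [u], the
    other for the rounding. *)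
Lemma cellwise_improve (f h : X -> 'cV[R]_k.+1) (eta : R) :
  meas_score_funs F f -> meas_score_funs F h -> 0 < eta ->
  exists2 u, meas_score_funs F u &
    (\int[P]_z (a * L (pred_score (f z.1)) z.2 + Hc eps + Phi (u z.1) z.2 - B)%:E
     <= \int[P]_z (Phi (f z.1) z.2 + a * L (pred_score (h z.1)) z.2 +
                   a * eps + 2 * eta - B)%:E)%E.
Proof.
move=> [Ff mf] [Fh mh] eta0.
pose level x := [ffun c => Num.floor (Phi (f x) c / eta)].
pose key x := pickle (pred_score (f x), pred_score (h x), level x).
have keyE x x' : key x = key x' -> [/\ pred_score (f x) = pred_score (f x'),
    pred_score (h x) = pred_score (h x') & level x = level x'].
  by move=> /(pcan_inj (@pickleK _)) [-> -> ->].
have mkey : measurable_fun setT key.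
  apply: (@measurable_fun_countable_factor _ _ _ _ _
    (fun x => (pred_score (f x), pred_score (h x), level x))); last first.
    by move=> x x' e; rewrite /key e.
  move=> [[p p'] l].
  have -> : (fun x => (pred_score (f x), pred_score (h x), level x)) @^-1`
      [set (p, p', l)] = [set x | pred_score (f x) = p] `&`
      [set x | pred_score (h x) = p'] `&` level @^-1` [set l].
    apply/seteqP; split=> x /= [].
      by move=> -> -> ->.
    by move=> [-> ->] ->.
  apply: measurableI; first by apply: measurableI; exact: measurable_fiber_pred_score.
  apply: measurable_fiber_ffun => c m; apply: measurable_fiber_floor.
  apply: measurable_funM => //.
  exact: (measurable_fun_continuous_score (@Phi_cont c) mf).
have mfib n : measurable (key @^-1` [set n]).
  by rewrite -[X in measurable X]setTI; exact: (mkey measurableT [set n]).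
pose m n := @cell_weight _ _ R k P (key @^-1` [set n]).
(* The score is chosen per key value, using any point of the cell as representative; values that are
   not attained get the score [0]. *)
have /choice [u hu] : forall n, exists u, score_set F u /\
    (key @^-1` [set n] !=set0 -> exists2 x, key x = n &
      \sum_c m n c * (a * L (pred_score (f x)) c + Hc eps + Phi u c - B) <=
      \sum_c m n c * (Phi (f x) c + a * L (pred_score (h x)) c +
                      a * eps + eta - B)).
  move=> n; have [[x kx]|] := pselect (key @^-1` [set n] !=set0).
    have [u Fu hu] := weighted_improve (Ff x) (Fh x)
      (fun c => cell_weight_ge0 P (key @^-1` [set n]) c) eta0.
    by exists u; split=> // _; exists x.
  by move=> n0; exists 0; split=> //; exact: score_set0.
have mu_score : meas_score_funs F (u \o key).
  split=> [x|i]; first exact: (hu _).1.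
  apply: (@measurable_fun_countable_factor _ _ _ _ _ key) => [n|x x' /= ->//].
  exact: mfib.
exists (u \o key) => //.
have mL v : meas_score_funs F v ->
    measurable_fun setT (fun z : X * 'I_k.+1 => a * L (pred_score (v z.1)) z.2).
  by move=> [_ mv]; apply: measurable_funM => //; exact: measurable_fun_task_loss.
have mPhi v : meas_score_funs F v ->
    measurable_fun setT (fun z : X * 'I_k.+1 => Phi (v z.1) z.2).
  by move=> [_ mv]; exact: (measurable_fun_surr_loss (@Phi_cont) mv).
have lhs0 v w y : 0 <= a * L v y + Hc eps + Phi w y - B.
  by have := mulr_ge0 a0 (L0 v y); have := PhiB w y; have := Hc_eps; lra.
have rhs0 v w y t : 0 <= t -> 0 <= Phi w y + a * L v y + a * eps + t - B.
  have := mulr_ge0 a0 (L0 v y); have := PhiB w y.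
  by have := mulr_ge0 a0 (ltW eps0); lra.
have fibE n : (fun z : X * 'I_k.+1 => key z.1) @^-1` [set n] =
    key @^-1` [set n] `*` setT.
  by apply/seteqP; split=> z //= [].
apply: (@ge0_le_integral_fibers _ _ _ _ (fun z => key z.1)).
- exact: measurableT_comp.
- apply/measurable_EFinP; apply: measurable_funB => //.
  apply: measurable_funD; last exact: mPhi.
  by apply: measurable_funD => //; exact: mL.
- apply/measurable_EFinP; apply: measurable_funB => //.
  apply: measurable_funD => //; apply: measurable_funD => //.
  by apply: measurable_funD; [exact: mPhi|exact: mL].
- by move=> z; rewrite lee_fin.
- by move=> z; rewrite lee_fin rhs0 // mulr_ge0 // ltW.
move=> n; rewrite fibE.
have [kn0|] := pselect (key @^-1` [set n] !=set0); last first.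
  by move/nonemptyPn => ->; rewrite set0X !integral_set0.
have [x kx hx] := (hu n).2 kn0.
rewrite (eq_integral (fun z =>
    (a * L (pred_score (f x)) z.2 + Hc eps + Phi (u n) z.2 - B)%:E)); last first.
  move=> z; rewrite inE => -[/= kz _].
  by have [-> _ _] := keyE z.1 x (etrans kz (esym kx)); rewrite kz.
rewrite (integral_label_cell P (G := fun y =>
  a * L (pred_score (f x)) y + Hc eps + Phi (u n) y - B)) //.
apply: (@le_trans _ _ (\int[P]_(z in key @^-1` [set n] `*` setT)
  (Phi (f x) z.2 + a * L (pred_score (h x)) z.2 + a * eps + eta - B)%:E)%E).
  rewrite (integral_label_cell P (G := fun y =>
    Phi (f x) y + a * L (pred_score (h x)) y + a * eps + eta - B)) //.
  by move=> c; rewrite rhs0 // ltW.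
apply: ge0_le_integral => //.
- exact: measurableX.
- by move=> z _; rewrite lee_fin rhs0 // ltW.
- apply/measurable_EFinP/measurable_funTS.
  apply: measurable_fun_label => c /=; exact: measurable_cst.
- apply/measurable_EFinP/measurable_funTS; apply: measurable_funB => //.
  apply: measurable_funD => //; apply: measurable_funD => //.
  by apply: measurable_funD; [exact: mPhi|exact: mL].
- move=> z [/= kz _]; rewrite lee_fin.
  have [_ <- /ffunP /(_ z.2)] := keyE z.1 x (etrans kz (esym kx)).
  rewrite !ffunE => e.
  have /andP[l1 _] := floor_itv (Phi (f z.1) z.2 / eta).
  have /andP[_ u1] := floor_itv (Phi (f x) z.2 / eta).
  (* Equal floors keep the losses at [x] and [z.1] within [eta] of each other, so the representative
     can be exchanged for the actual point. *)
  have : Phi (f x) z.2 / eta < Phi (f z.1) z.2 / eta + 1.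
    by apply: lt_le_trans u1 _; rewrite -e intrD lerD2r.
  by rewrite -(ltr_pM2r eta0) mulrDl !divfK ?gt_eqF // mul1r; lra.
Qed.

End Averaging.

(** * Integrals of real functions *)

Section RealIntegrals.
Context {d : measure_display} {T : measurableType d} {R : realType}.
Variable P : probability T R.

Definition integrable_real (f : T -> R) : Prop := P.-integrable setT (EFin \o f).

Lemma integrable_realD f g : integrable_real f -> integrable_real g ->
  integrable_real (fun z => f z + g z).
Proof. by move=> fi gi; exact: (integrableD measurableT fi gi). Qed.

Lemma integrable_realZ c f : integrable_real f ->
  integrable_real (fun z => c * f z).
Proof. by move=> fi; apply: (integrableZl measurableT c fi). Qed.

Lemma integrable_real_cst c : integrable_real (fun=> c).
Proof. by apply: finite_measure_integrable_cst. Qed.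

Lemma integrable_realB f g : integrable_real f -> integrable_real g ->
  integrable_real (fun z => f z - g z).
Proof. by move=> fi gi; exact: (integrableB measurableT fi gi). Qed.

Lemma integrable_real_sum (I : Type) (s : seq I) (f : I -> T -> R) :
  (forall i, integrable_real (f i)) ->
  integrable_real (fun z => \sum_(i <- s) f i z).
Proof.
move=> fi; elim: s => [|i s IH].
  by under eq_fun do rewrite big_nil; exact: integrable_real_cst.
by under eq_fun do rewrite big_cons; exact: integrable_realD.
Qed.

Lemma integrable_real_measurable f : integrable_real f -> measurable_fun setT f.
Proof. by move=> /measurable_int /measurable_EFinP. Qed.

Lemma integrable_real_bounded (f : T -> R) (b c : R) : measurable_fun setT f ->
  (forall z, b <= f z <= c) -> integrable_real f.
Proof.
move=> mf bfc; apply: measurable_bounded_integrable => //.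
  by rewrite [X in (X < _)%E]probability_setT ltry.
exists (`|b| + `|c|); split; first exact: num_real.
move=> M hM z _ /=; apply: ltW; apply: le_lt_trans hM.
have /andP[h1 h2] := bfc z; rewrite ler_norml; apply/andP; split.
  by have := ler_norm (- b); rewrite normrN; have := normr_ge0 c; lra.
by apply: le_trans h2 _; have := ler_norm c; have := normr_ge0 b; lra.
Qed.

Lemma integrable_real_sandwich (g h f : T -> R) : measurable_fun setT f ->
  integrable_real g -> integrable_real h -> (forall z, g z <= f z <= h z) ->
  integrable_real f.
Proof.
move=> mf gi hi gfh.
apply: (@le_integrable _ _ _ _ _ _ _ (EFin \o (fun z => `|g z| + `|h z|))) => //.
- exact/measurable_EFinP.
- move=> z _ /=; rewrite lee_fin [leRHS]ger0_norm ?addr_ge0 //.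
  have /andP[h1 h2] := gfh z; rewrite ler_norml; apply/andP; split.
    by have := ler_norm (- g z); rewrite normrN; have := normr_ge0 (h z); lra.
  by have := ler_norm (h z); have := normr_ge0 (g z); lra.
- by apply: integrable_realD; exact: integrable_norm.
Qed.

Lemma ge0_integrable_real (f : T -> R) : measurable_fun setT f -> (forall z, 0 <= f z) ->
  (\int[P]_z (f z)%:E < +oo)%E -> integrable_real f.
Proof.
move=> mf f0 foo; apply/integrableP; split; first exact/measurable_EFinP.
by under eq_integral do rewrite /= ger0_norm //.
Qed.

(* The integral in the sense of the difference of the positive and negative
   parts is [+oo] for a function bounded below that is not integrable. *)
Lemma bounded_below_integrable (f : T -> R) (b : R) : measurable_fun setT f ->
  (forall z, b <= f z) -> (\int[P]_z (f z)%:E < +oo)%E -> integrable_real f.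
Proof.
move=> mf bf foo.
have neg_fin : (\int[P]_z ((EFin \o f)^\- z) < +oo)%E.
  apply: le_lt_trans (ltry `|b|).
  have -> : (`|b|%:E = \int[P]_z (cst `|b|%:E) z)%E.
    by rewrite integral_cst // [X in (_ * X)%E]probability_setT mule1.
  apply: ge0_le_integral => //.
  - exact/measurable_funeneg/measurable_EFinP.
  - move=> z _; rewrite funenegE /= -EFin_max lee_fin ge_max normr_ge0 andbT.
    by have := bf z; have := ler_norm (- b); rewrite normrN; lra.
move: foo; rewrite integralE => foo.
have pos_fin : (\int[P]_z ((EFin \o f)^\+ z) < +oo)%E.
  rewrite ltNge leye_eq; apply/negP => /eqP pos; move: foo.
  rewrite pos; move: neg_fin.
  have : (0 <= \int[P]_z ((EFin \o f)^\- z))%E by exact: integral_ge0.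
  by case: (\int[P]_z _)%E.
apply/integrableP; split; first exact/measurable_EFinP.
rewrite -/(abse \o (EFin \o f)) fune_abse ge0_integralD //.
- exact: lte_add_pinfty.
- exact/measurable_funepos/measurable_EFinP.
- exact/measurable_funeneg/measurable_EFinP.
Qed.

Local Notation E f := (\int[P]_z f z)%R.

Lemma EFin_Rintegral f : integrable_real f -> (\int[P]_z (f z)%:E)%E = (E f)%:E.
Proof. by move=> fi; rewrite /Rintegral fineK //; exact: integrable_fin_num. Qed.

Lemma mean_cst (c : R) : E (fun=> c) = c.
Proof. by rewrite Rintegral_cst // [X in _ * fine X]probability_setT /= mulr1. Qed.

Lemma meanD f g : integrable_real f -> integrable_real g ->
  \int[P]_z (f z + g z) = E f + E g.
Proof. by move=> fi gi; exact: RintegralD. Qed.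

Lemma meanB f g : integrable_real f -> integrable_real g ->
  \int[P]_z (f z - g z) = E f - E g.
Proof. by move=> fi gi; exact: RintegralB. Qed.

Lemma meanZ c f : integrable_real f -> \int[P]_z (c * f z) = c * E f.
Proof. by move=> fi; exact: RintegralZl. Qed.

Lemma mean_sum (I : Type) (s : seq I) (f : I -> T -> R) :
  (forall i, integrable_real (f i)) ->
  \int[P]_z (\sum_(i <- s) f i z) = \sum_(i <- s) E (f i).
Proof.
move=> fi; elim: s => [|i s IH].
  under eq_Rintegral do rewrite big_nil.
  by rewrite big_nil mean_cst.
under eq_Rintegral do rewrite big_cons.
by rewrite big_cons meanD // ?IH //; exact: integrable_real_sum.
Qed.

Lemma le_mean f g : integrable_real f -> integrable_real g ->
  (forall z, f z <= g z) -> E f <= E g.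
Proof. by move=> fi gi fg; apply: le_Rintegral => // z _; exact: fg. Qed.

End RealIntegrals.

(** * From surrogate excess to task excess *)

Section ExcessTransfer.
Context {d : measure_display} {X : measurableType d} {R : realType} {k r : nat}.
Variable P : probability (X * 'I_k.+1)%type R.
Variables (L : 'M[R]_k.+1) (F : 'M[R]_(k.+1, r)).
Variable (Phi : 'cV[R]_k.+1 -> 'I_k.+1 -> R).
Hypothesis L0 : forall i j, 0 <= L i j.
Hypothesis Phi_cont : forall y, continuous (fun f => Phi f y).

Definition mean_L (f : X -> 'cV[R]_k.+1) : R :=
  \int[P]_z L (pred_score (f z.1)) z.2.

Definition mean_Phi (f : X -> 'cV[R]_k.+1) : R := \int[P]_z Phi (f z.1) z.2.

Definition integrable_Phi (f : X -> 'cV[R]_k.+1) : Prop :=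
  integrable_real P (fun z => Phi (f z.1) z.2).

Lemma integrable_L (f : X -> 'cV[R]_k.+1) : meas_score_funs F f ->
  integrable_real P (fun z => L (pred_score (f z.1)) z.2).
Proof.
move=> [_ mf].
apply: (@integrable_real_bounded _ _ _ _ _ 0 (\sum_i \sum_j L i j)).
  exact: measurable_fun_task_loss.
move=> z; rewrite L0 /= (bigD1 (pred_score (f z.1))) //= (bigD1 z.2) //=.
by rewrite -addrA lerDl addr_ge0 ?sumr_ge0 // => i _; rewrite sumr_ge0.
Qed.

Lemma risk_L_mean (f : X -> 'cV[R]_k.+1) : meas_score_funs F f ->
  risk_L P L f = (mean_L f)%:E.
Proof. by move=> /integrable_L; exact: EFin_Rintegral. Qed.

Lemma mean_L_ge0 (f : X -> 'cV[R]_k.+1) : 0 <= mean_L f.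
Proof. by apply: Rintegral_ge0 => z _; exact: L0. Qed.

Variables (Hc : R -> R) (eps a B opt : R).
Hypothesis PhiB : forall f y, B <= Phi f y.
Hypothesis eps0 : 0 < eps.
Hypothesis a0 : 0 <= a.
Hypothesis Hc_eps : 0 <= Hc eps.
Hypothesis Hc_supp : forall e, 0 <= e -> Hc eps + a * (e - eps) <= Hc e.
Hypothesis Hc_lb : forall e, 0 <= e -> ((Hc e)%:E <= calibration_fun Phi L F e)%E.
Hypothesis opt_le : forall u, meas_score_funs F u -> integrable_Phi u ->
  opt <= mean_Phi u.

(** Integrates the cell-wise inequality and bounds the surrogate risk of its piecewise constant
    competitor [u] below by [opt]. *)
Lemma excess_transfer (f h : X -> 'cV[R]_k.+1) :
  meas_score_funs F f -> meas_score_funs F h -> integrable_Phi f ->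
  a * mean_L f + Hc eps + opt <= mean_Phi f + a * mean_L h + a * eps.
Proof.
move=> mf mh iPhi; apply/ler_addgt0Pr => e e0.
(* The two losses of [e / 2] in [cellwise_improve] add up to [e]. *)
have e20 : 0 < e / 2 by rewrite divr_gt0.
have [u mu] := cellwise_improve P L0 Phi_cont PhiB eps0 a0 Hc_eps Hc_supp Hc_lb
  mf mh e20.
pose lhs u (z : X * 'I_k.+1) :=
  a * L (pred_score (f z.1)) z.2 + Hc eps + Phi (u z.1) z.2 - B.
have iaL v : meas_score_funs F v ->
    integrable_real P (fun z => a * L (pred_score (v z.1)) z.2).
  by move=> mv; apply: integrable_realZ; exact: integrable_L.
have mphiu : measurable_fun setT (fun z : X * 'I_k.+1 => Phi (u z.1) z.2).
  exact: (measurable_fun_surr_loss (@Phi_cont) mu.2).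
have ic c : integrable_real P (fun=> c) by exact: integrable_real_cst.
have irhs : integrable_real P (fun z => Phi (f z.1) z.2 +
    a * L (pred_score (h z.1)) z.2 + a * eps + 2 * (e / 2) - B).
  do 3! [apply: integrable_realB => // || apply: integrable_realD => //].
  by apply: integrable_realD => //; exact: iaL.
rewrite (EFin_Rintegral irhs) => le_u.
(* The inequality itself yields integrability: its nonnegative left integrand has a finite integral,
   and the terms other than the loss of [u] are integrable. *)
have iu : integrable_Phi u.
  have ilhs : integrable_real P (fun z =>
      a * L (pred_score (f z.1)) z.2 + Hc eps + Phi (u z.1) z.2 - B).
    apply: ge0_integrable_real.
    - apply: measurable_funB => //; apply: measurable_funD => //.
      by apply: measurable_funD => //; exact: integrable_real_measurable (iaL _ mf).
    - move=> z; have := mulr_ge0 a0 (L0 (pred_score (f z.1)) z.2).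
      by have := PhiB (u z.1) z.2; have := Hc_eps; lra.
    - by apply: le_lt_trans le_u _; exact: ltry.
  have := integrable_realB ilhs (integrable_realB (iaL _ mf) (ic (B - Hc eps))).
  by congr (integrable_real P); apply/funext => z; ring.
move: le_u; rewrite EFin_Rintegral; last first.
  do 3! [apply: integrable_realB => // || apply: integrable_realD => //].
  exact: iaL.
rewrite lee_fin.
rewrite !(meanB, meanD, mean_cst, meanZ); rewrite -?/(mean_L _) -?/(mean_Phi _).
1: by have := opt_le mu iu; lra.
all: do ?[exact: ic | exact: iaL | exact: integrable_L | exact: iu | exact: iPhi
         | apply: integrable_realB | apply: integrable_realD].
Qed.

End ExcessTransfer.

(** * Hilbert-Schmidt geometry of the gradient step *)

Section HilbertSchmidt.
Context {R : realType} {V : normedModType R} {ip : V -> V -> R}.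
Hypothesis hip : inner_product ip.

Lemma ip_sym u v : ip u v = ip v u.
Proof. by case: hip. Qed.

Lemma ip_linear a u v w : ip (a *: u + v) w = a * ip u w + ip v w.
Proof. by case: hip. Qed.

Lemma ip_norm v : ip v v = `|v| ^+ 2.
Proof. by case: hip. Qed.

Lemma ip0 w : ip 0 w = 0.
Proof. by have := ip_linear 1 0 0 w; rewrite scaler0 addr0 mul1r; lra. Qed.

Lemma ipZ a u w : ip (a *: u) w = a * ip u w.
Proof. by have := ip_linear a u 0 w; rewrite addr0 ip0 addr0. Qed.

Lemma ipD u v w : ip (u + v) w = ip u w + ip v w.
Proof. by have := ip_linear 1 u v w; rewrite scale1r mul1r. Qed.

Lemma ipB u v w : ip (u - v) w = ip u w - ip v w.
Proof. by rewrite ipD -scaleN1r ipZ mulN1r. Qed.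

Lemma ip_sum (I : Type) (s : seq I) (f : I -> V) w :
  ip (\sum_(i <- s) f i) w = \sum_(i <- s) ip (f i) w.
Proof.
by elim: s => [|i s IH]; rewrite ?big_nil ?ip0 // !big_cons ipD IH.
Qed.

Lemma sqr_normB u v : `|u - v| ^+ 2 = `|u| ^+ 2 - 2 * ip u v + `|v| ^+ 2.
Proof.
rewrite -!ip_norm ipB ip_sym ipB [ip v (u - v)]ip_sym ipB [ip v u]ip_sym; ring.
Qed.

Definition hs_dist2 (r : nat) (w w' : 'I_r -> V) : R := \sum_j `|w j - w' j| ^+ 2.

Context {r : nat}.
Implicit Types w : 'I_r -> V.

Lemma hs_dist2_ge0 w w' : 0 <= hs_dist2 w w'.
Proof. by apply: sumr_ge0 => j _; rewrite sqr_ge0. Qed.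

Lemma hs_norm_ge0 w : 0 <= hs_norm w.
Proof. exact: sqrtr_ge0. Qed.

Lemma sqr_hs_norm w : hs_norm w ^+ 2 = \sum_j `|w j| ^+ 2.
Proof. by rewrite sqr_sqrtr // sumr_ge0 // => j _; rewrite sqr_ge0. Qed.

Lemma hs_norm_le0 w : hs_norm w <= 0 -> forall j, w j = 0.
Proof.
move=> w0 j; have /eqP : hs_norm w = 0 by apply/eqP; rewrite eq_le w0 hs_norm_ge0.
rewrite -sqrf_eq0 sqr_hs_norm psumr_eq0 => [/allP /(_ j)|i _]; last exact: sqr_ge0.
by rewrite mem_index_enum sqrf_eq0 normr_eq0 => /(_ isT) /eqP.
Qed.

Lemma hs_norm0 : hs_norm (fun _ : 'I_r => 0 : V) = 0.
Proof.
by rewrite /hs_norm big1 ?sqrtr0 // => j _; rewrite normr0 expr0n.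
Qed.

Lemma hs_dist2_expand w w' : hs_dist2 w w' =
  hs_norm w ^+ 2 - 2 * (\sum_j ip (w j) (w' j)) + hs_norm w' ^+ 2.
Proof.
rewrite !sqr_hs_norm mulr_sumr -sumrB -big_split /=.
by apply: eq_bigr => j _; exact: sqr_normB.
Qed.

Lemma hs_norm_scale a w : hs_norm (fun j => a *: w j) = `|a| * hs_norm w.
Proof.
apply/eqP; rewrite -(@eqrXn2 _ 2) ?mulr_ge0 ?hs_norm_ge0 //.
rewrite exprMn !sqr_hs_norm mulr_sumr; apply/eqP/eq_bigr => j _.
by rewrite normrZ exprMn.
Qed.

Lemma hs_norm_proj_ball D w : 0 <= D -> hs_norm (proj_ball D w) <= D.
Proof.
move=> D0; rewrite /proj_ball; case: ifPn => // /negbTE; rewrite leNgt => /negbFE wD.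
rewrite hs_norm_scale ger0_norm ?divr_ge0 ?hs_norm_ge0 //.
by rewrite divfK // gt_eqF // (le_lt_trans D0).
Qed.

(** Outside the ball, let [s] be the norm of [w] and [t] the inner product of [w] and [ws] divided
    by [s]. The squared distance drops by [(s - D) * (s + D - 2 * t)], which is nonnegative once
    [t <= D]. *)
Lemma hs_dist2_proj_ball D w ws : 0 < D -> hs_norm ws <= D ->
  hs_dist2 (proj_ball D w) ws <= hs_dist2 w ws.
Proof.
move=> D0 wsD; rewrite /proj_ball; case: ifPn => // /negbTE.
rewrite leNgt => /negbFE wD.
have s0 : 0 < hs_norm w by exact: lt_trans wD.
have sc : hs_norm (fun j => (D / hs_norm w) *: w j) = D.
  by rewrite hs_norm_scale ger0_norm ?divr_ge0 ?ltW // divfK // gt_eqF.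
(* Nonnegativity of this squared distance takes the place of Cauchy-Schwarz: it gives
   [2 * D * t <= D ^+ 2 + n ^+ 2], hence [t <= D]. *)
have := hs_dist2_ge0 (fun j => (D / hs_norm w) *: w j) ws.
rewrite !hs_dist2_expand sc.
under eq_bigr do rewrite ipZ.
rewrite -mulr_sumr; set c := \sum_j _; set s := hs_norm w in s0 wD *.
have n0 := hs_norm_ge0 ws; set n := hs_norm ws in wsD n0 *.
have -> : D / s * c = D * (c / s) by rewrite mulrAC mulrA.
have cE : c = s * (c / s) by rewrite mulrC divfK // gt_eqF.
set t := c / s in cE *; rewrite cE => h.
have tD : t <= D.
  have : 2 * D * t <= 2 * D * D by nra.
  by rewrite ler_pM2l // mulr_gt0.
have : 0 <= (s - D) * (s + D - 2 * t) by apply: mulr_ge0; lra.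
by lra.
Qed.

(** The squared distance from [w] to the opposite of [w'] is nonnegative, which bounds the cross
    term by the sum of the squared norms. *)
Lemma hs_dist2_ball D w w' : hs_norm w <= D -> hs_norm w' <= D ->
  hs_dist2 w w' <= 4 * D ^+ 2.
Proof.
move=> wD w'D.
have := hs_dist2_ge0 w (fun j => -1 *: w' j).
rewrite !hs_dist2_expand hs_norm_scale normrN1 mul1r.
under eq_bigr do rewrite ip_sym ipZ mulN1r ip_sym.
rewrite sumrN => h.
have sqD (v : 'I_r -> V) : hs_norm v <= D -> hs_norm v ^+ 2 <= D ^+ 2.
  by move=> vD; rewrite !expr2; apply: ler_pM => //; exact: hs_norm_ge0.
have := sqD _ wD; have := sqD _ w'D.
by lra.
Qed.

End HilbertSchmidt.

Section Step.
Context {R : realType} {X : Type} {V : normedModType R}.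
Variable ip : V -> V -> R.
Hypothesis hip : inner_product ip.
Context {k r : nat}.
Variables (psi : X -> V) (F : 'M[R]_(k.+1, r)).

Definition score (w : 'I_r -> V) (x : X) : 'cV[R]_k.+1 := F *m apply_op ip w (psi x).

Variables (Phi : 'cV[R]_k.+1 -> 'I_k.+1 -> R)
  (g : 'cV[R]_k.+1 -> 'I_k.+1 -> 'cV[R]_k.+1).
Hypothesis subgrad : forall (f : 'cV[R]_k.+1) y (f' : 'cV[R]_k.+1),
  Phi f y + \sum_c g f y c 0 * (f' c 0 - f c 0) <= Phi f' y.

(** The rows of the operator $F^\top g\,\psi(x)^\top$, the stochastic gradient with respect to
    $W$. *)
Definition hs_grad (w : 'I_r -> V) (z : X * 'I_k.+1) : 'I_r -> V :=
  fun j => (F^T *m g (score w z.1) z.2) j 0 *: psi z.1.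

(** The chain rule for subgradients: the score is linear in [w], and [F^T] moves the subgradient
    from scores to operators. *)
Lemma hs_grad_subgrad (w ws : 'I_r -> V) (z : X * 'I_k.+1) :
  Phi (score w z.1) z.2 - Phi (score ws z.1) z.2 <=
  \sum_j ip (hs_grad w z j) (w j - ws j).
Proof.
have := subgrad (score w z.1) z.2 (score ws z.1).
suff -> : \sum_j ip (hs_grad w z j) (w j - ws j) =
   - \sum_c g (score w z.1) z.2 c 0 * (score ws z.1 c 0 - score w z.1 c 0) by lra.
rewrite -sumrN.
under eq_bigr do rewrite (ipZ hip) (ip_sym hip) (ipB hip) mxE mulr_suml.
rewrite exchange_big /=; apply: eq_bigr => c _.
rewrite !mxE -sumrB mulr_sumr -sumrN; apply: eq_bigr => j _.
by rewrite !mxE; ring.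
Qed.

(** Nonexpansiveness towards [ws], then the expanded square with its cross term bounded by the
    subgradient inequality. *)
Lemma hs_dist2_step (w ws : 'I_r -> V) (D gamma : R) (z : X * 'I_k.+1) :
  0 < D -> 0 <= gamma -> hs_norm ws <= D ->
  hs_dist2 (proj_ball D (fun j => w j - gamma *: hs_grad w z j)) ws <=
  hs_dist2 w ws - 2 * gamma * (Phi (score w z.1) z.2 - Phi (score ws z.1) z.2) +
    gamma ^+ 2 * hs_norm (hs_grad w z) ^+ 2.
Proof.
move=> D0 gam0 wsD; apply: le_trans (hs_dist2_proj_ball hip _ D0 wsD) _.
have -> : hs_dist2 (fun j => w j - gamma *: hs_grad w z j) ws =
  hs_dist2 w ws - 2 * gamma * (\sum_j ip (hs_grad w z j) (w j - ws j)) +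
    gamma ^+ 2 * hs_norm (hs_grad w z) ^+ 2.
  rewrite sqr_hs_norm /hs_dist2 !mulr_sumr -sumrB -big_split /=.
  apply: eq_bigr => j _; rewrite addrAC (sqr_normB hip) normrZ exprMn.
  by rewrite -normrX ger0_norm ?sqr_ge0 // [ip _ (_ *: _)](ip_sym hip) (ipZ hip) mulrA.
by have := ler_wpM2l gam0 (hs_grad_subgrad w ws z); lra.
Qed.

(** Jensen's inequality from the subgradient at the average: the linear terms cancel because the
    score is linear in the operator. *)
Lemma surr_loss_average (I : Type) (s : seq I) (w : I -> 'I_r -> V) (wb : 'I_r -> V)
    (z : X * 'I_k.+1) :
  (forall j, (size s)%:R *: wb j = \sum_(t <- s) w t j) ->
  (size s)%:R * Phi (score wb z.1) z.2 <= \sum_(t <- s) Phi (score (w t) z.1) z.2.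
Proof.
move=> hwb.
have sumc c : \sum_(t <- s) (score (w t) z.1 c 0 - score wb z.1 c 0) = 0.
  rewrite big_split /= sumrN big_const_seq count_predT iter_addr_0 -mulr_natl.
  apply/eqP; rewrite subr_eq0 !mxE mulr_sumr; apply/eqP.
  under eq_bigr do rewrite mxE.
  rewrite exchange_big /=; apply: eq_bigr => j _.
  rewrite !mxE mulrCA -(ipZ hip) hwb (ip_sum hip) mulr_sumr.
  by under eq_bigr do rewrite mxE.
have : \sum_(t <- s) (Phi (score wb z.1) z.2 + \sum_c g (score wb z.1) z.2 c 0 *
    (score (w t) z.1 c 0 - score wb z.1 c 0)) <= \sum_(t <- s) Phi (score (w t) z.1) z.2.
  by apply: ler_sum => t _; exact: subgrad.
rewrite big_split /= exchange_big /=.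
under [X in _ + X <= _]eq_bigr do rewrite -mulr_sumr sumc mulr0.
by rewrite big1_eq addr0 big_const_seq count_predT iter_addr_0 mulr_natl.
Qed.

End Step.

(** * Regret in expectation *)

Section IteratedExpectation.
Context {d : measure_display} {T : measurableType d} {R : realType}.
Variable P : probability T R.
Local Open Scope ereal_scope.

Lemma iid_expect_ge0 n (G : seq T -> \bar R) : (forall s, 0 <= G s) ->
  0 <= iid_expect P n G.
Proof.
elim: n G => [|n IH] G G0 /=; first exact: G0.
by apply: integral_ge0 => z _; apply: IH => s; exact: G0.
Qed.

Lemma integral_le_cst (f : T -> \bar R) (c : R) : (forall z, 0 <= f z) ->
  (forall z, f z <= c%:E) -> \int[P]_z f z <= c%:E.
Proof.
move=> f0 fc; apply: le_trans (ge0_le_integral_nonmeasurable P f0 fc) _.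
by rewrite integral_cst // [X in _ * X]probability_setT mule1.
Qed.

Lemma iid_expect_le_cst n (G : seq T -> \bar R) (c : R) : (forall s, 0 <= G s) ->
  (forall s, size s = n -> G s <= c%:E) -> iid_expect P n G <= c%:E.
Proof.
elim: n G => [|n IH] G G0 Gc /=; first exact: Gc.
apply: integral_le_cst => z; first by apply: iid_expect_ge0 => s; exact: G0.
by apply: IH => s => [|sn]; [exact: G0|apply: Gc; rewrite /= sn].
Qed.

End IteratedExpectation.

Section Descent.
Context {d : measure_display} {X : measurableType d} {R : realType} {k r : nat}.
Context {V : normedModType R} {ip : V -> V -> R}.
Hypothesis hip : inner_product ip.
Variables (P : probability (X * 'I_k.+1)%type R) (F : 'M[R]_(k.+1, r)) (psi : X -> V).
Hypothesis norm_psi_meas : measurable_fun setT (fun x => `|psi x| ^+ 2).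
Hypothesis psi_meas : forall h : V, measurable_fun setT (fun x => ip h (psi x)).
Variables (Phi : 'cV[R]_k.+1 -> 'I_k.+1 -> R) (B : R).
Hypothesis Phi_cont : forall y, continuous (fun f => Phi f y).
Hypothesis PhiB : forall f y, B <= Phi f y.
Variable g : 'cV[R]_k.+1 -> 'I_k.+1 -> 'cV[R]_k.+1.
Hypothesis subgrad : forall (f : 'cV[R]_k.+1) y (f' : 'cV[R]_k.+1),
  Phi f y + \sum_c g f y c 0 * (f' c 0 - f c 0) <= Phi f' y.
Hypothesis g_meas : forall y i, measurable_fun setT
  (fun t : k.+1.-tuple R => g (\col_c tnth t c) y i 0).
Variables (D M : R).
Hypothesis D0 : 0 < D.
Hypothesis grad_bound : forall w : 'I_r -> V, hs_norm w <= D ->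
  (\int[P]_z (hs_norm (hs_grad ip psi F g w z) ^+ 2)%:E <= (M ^+ 2)%:E)%E.

Local Notation score := (@score R X V ip k r psi F).

Lemma meas_score (w : 'I_r -> V) : meas_score_funs F (score w).
Proof.
split=> [x|i]; first by exists (apply_op ip w (psi x)).
apply: measurable_fun_mulmx => j.
by under eq_fun do rewrite mxE; exact: psi_meas.
Qed.

Lemma sqr_hs_grad (w : 'I_r -> V) z : hs_norm (hs_grad ip psi F g w z) ^+ 2 =
  (\sum_j (F^T *m g (score w z.1) z.2) j 0 ^+ 2) * `|psi z.1| ^+ 2.
Proof.
rewrite sqr_hs_norm mulr_suml; apply: eq_bigr => j _.
by rewrite normrZ exprMn -normrX ger0_norm ?sqr_ge0.
Qed.

Lemma measurable_sqr_hs_grad (w : 'I_r -> V) :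
  measurable_fun setT (fun z => hs_norm (hs_grad ip psi F g w z) ^+ 2).
Proof.
under eq_fun do rewrite sqr_hs_grad.
apply: measurable_fun_label => c /=; apply: measurable_funM => //.
apply: measurable_sum => j; apply: measurable_funX; apply: measurable_fun_mulmx => i.
(* [g_meas] speaks of tuples, so the score is passed through the tuple of its coordinates. *)
have -> : (fun x => g (score w x) c i 0) =
    (fun t : k.+1.-tuple R => g (\col_c tnth t c) c i 0) \o
    (fun x => [tuple score w x i 0 | i < k.+1]).
  apply/funext => x /=; congr (g _ c i 0); apply/matrixP => i' j'.
  by rewrite mxE tnth_mktuple (ord1 j').
apply: measurableT_comp; first exact: g_meas.
apply/measurable_fun_tnthP => i'.
rewrite (_ : _ \o _ = fun x => score w x i' 0); first exact: (meas_score w).2.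
by apply/funext => x /=; rewrite tnth_mktuple.
Qed.

Lemma integrable_sqr_hs_grad (w : 'I_r -> V) : hs_norm w <= D ->
  integrable_real P (fun z => hs_norm (hs_grad ip psi F g w z) ^+ 2).
Proof.
move=> wD; apply: ge0_integrable_real; first exact: measurable_sqr_hs_grad.
  by move=> z; exact: sqr_ge0.
by apply: le_lt_trans (grad_bound wD) _; exact: ltry.
Qed.

Lemma mean_sqr_hs_grad (w : 'I_r -> V) : hs_norm w <= D ->
  \int[P]_z (hs_norm (hs_grad ip psi F g w z) ^+ 2) <= M ^+ 2.
Proof.
move=> wD; rewrite -lee_fin -EFin_Rintegral ?grad_bound //.
exact: integrable_sqr_hs_grad.
Qed.

Lemma measurable_Phi_score (w : 'I_r -> V) :
  measurable_fun setT (fun z : X * 'I_k.+1 => Phi (score w z.1) z.2).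
Proof. exact: (measurable_fun_surr_loss (@Phi_cont) (meas_score w).2). Qed.

Variable ws : 'I_r -> V.
Hypothesis wsD : hs_norm ws <= D.
Hypothesis int_ws : integrable_Phi P Phi (score ws).

(** Integrability spreads from [ws] to the whole ball: the subgradient inequality bounds the loss at
    [w] by that at [ws] plus an inner product, which is split into squares. *)
Lemma integrable_Phi_score (w : 'I_r -> V) : hs_norm w <= D ->
  integrable_Phi P Phi (score w).
Proof.
move=> wD; apply: (@integrable_real_sandwich _ _ _ _ (fun=> B)
  (fun z => Phi (score ws z.1) z.2 +
    2^-1 * (hs_norm (hs_grad ip psi F g w z) ^+ 2 + hs_dist2 w ws))).
- exact: measurable_Phi_score.
- exact: integrable_real_cst.
- apply: integrable_realD => //; apply: integrable_realZ; apply: integrable_realD.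
    exact: integrable_sqr_hs_grad.
  exact: integrable_real_cst.
- move=> z; rewrite PhiB /=.
  have := hs_grad_subgrad hip psi F subgrad w ws z.
  (* Young's inequality, as nonnegativity of the squared distance between the gradient and
     [w - ws]. *)
  have := hs_dist2_ge0 (hs_grad ip psi F g w z) (fun j => w j - ws j).
  by rewrite (hs_dist2_expand hip) [X in _ + X]sqr_hs_norm -/(hs_dist2 w ws); lra.
Qed.

Local Notation rho w := (mean_Phi P Phi (score w) - mean_Phi P Phi (score ws)).

(** An integrable function of the sample that dominates the squared distance to [ws] after one step
    and is integrated in its place. *)
Definition step_bound (gamma : R) (w : 'I_r -> V) (z : X * 'I_k.+1) : R :=
  hs_dist2 w ws - 2 * gamma * (Phi (score w z.1) z.2 - Phi (score ws z.1) z.2) +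
  gamma ^+ 2 * hs_norm (hs_grad ip psi F g w z) ^+ 2.

Lemma integrable_step_bound gamma (w : 'I_r -> V) : hs_norm w <= D ->
  integrable_real P (step_bound gamma w).
Proof.
move=> wD; apply: integrable_realD; last first.
  by apply: integrable_realZ; exact: integrable_sqr_hs_grad.
apply: integrable_realB; first exact: integrable_real_cst.
by apply: integrable_realZ; apply: integrable_realB => //; exact: integrable_Phi_score.
Qed.

Lemma mean_step_bound gamma (w : 'I_r -> V) : hs_norm w <= D ->
  \int[P]_z step_bound gamma w z <=
  hs_dist2 w ws - 2 * gamma * rho w + gamma ^+ 2 * M ^+ 2.
Proof.
move=> wD; have ig := integrable_sqr_hs_grad wD.
have iw := integrable_Phi_score wD.
have id : integrable_real P (fun z => Phi (score w z.1) z.2 - Phi (score ws z.1) z.2).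
  exact: integrable_realB.
have ic c : integrable_real P (fun=> c) by exact: integrable_real_cst.
rewrite meanD; [|by apply: integrable_realB => //; exact: integrable_realZ
                |exact: integrable_realZ].
rewrite meanB //; last exact: integrable_realZ.
rewrite mean_cst !meanZ // meanB // lerD2l.
by apply: ler_wpM2l; [exact: sqr_ge0|exact: mean_sqr_hs_grad].
Qed.

Variable gamma : R.
Hypothesis gamma0 : 0 < gamma.

Local Notation step := (asgd_step ip psi F g D gamma).

Lemma hs_norm_step (w : 'I_r -> V) z : hs_norm (step w z) <= D.
Proof. by apply: hs_norm_proj_ball; exact: ltW. Qed.

Lemma hs_dist2_asgd_step (w : 'I_r -> V) z :
  hs_dist2 (step w z) ws <= step_bound gamma w z.
Proof.
apply: le_trans (hs_dist2_step hip psi F subgrad w z D0 (ltW gamma0) wsD).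
rewrite /asgd_step; set u := proj_ball D _; set u' := proj_ball D _.
suff -> : u = u' by [].
by congr proj_ball; apply/funext => j; rewrite scalerA.
Qed.

(** The mean of the one-step bound is nonnegative because the bound dominates a squared distance.
    This controls the last iterate, after which no sample is drawn. *)
Lemma rho_le (w : 'I_r -> V) : hs_norm w <= D ->
  2 * gamma * rho w <= hs_dist2 w ws + gamma ^+ 2 * M ^+ 2.
Proof.
move=> wD; have := mean_step_bound gamma wD.
have : 0 <= \int[P]_z step_bound gamma w z.
  apply: Rintegral_ge0 => z _; apply: le_trans (hs_dist2_asgd_step w z).
  exact: hs_dist2_ge0.
lra.
Qed.

(* [c], [kappa] and [A] parametrize an affine function of the regret, [A] being
   the part of it accumulated before the current state [w]. *)
Lemma iid_expect_regret (c kappa : R) n (w : 'I_r -> V) (A : R)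
    (G : seq (X * 'I_k.+1) -> \bar R) :
  0 <= kappa -> hs_norm w <= D -> (forall s, (0 <= G s)%E) ->
  (forall s, size s = n -> (G s <=
     (c + kappa * (A + rho w +
        \sum_(1 <= t < n.+1) rho (foldl step w (take t s))))%:E)%E) ->
  (iid_expect P n G <= (c + kappa * (A +
     (hs_dist2 w ws + n.+1%:R * (gamma ^+ 2 * M ^+ 2)) / (2 * gamma)))%:E)%E.
Proof.
move=> kappa0; have g20 : 0 < 2 * gamma by rewrite mulr_gt0.
elim: n w A G => [|n IH] w A G wD G0 hG.
  apply: le_trans (hG [::] erefl) _; rewrite big_geq // addr0 mul1r.
  rewrite lee_fin lerD2l ler_wpM2l // lerD2l ler_pdivlMr // mulrC.
  exact: rho_le.
have gM0 : 0 <= gamma ^+ 2 * M ^+ 2 by rewrite mulr_ge0 ?sqr_ge0.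
set C := n.+1%:R * (gamma ^+ 2 * M ^+ 2).
(* With the first sample fixed, the induction hypothesis starts from the next iterate, and the
   regret of [w] moves into the accumulated part. *)
have Hz z : (iid_expect P n (fun s => G (z :: s)) <=
    (c + kappa * (A + rho w + (step_bound gamma w z + C) / (2 * gamma)))%:E)%E.
  apply: (@le_trans _ _ (c + kappa * (A + rho w +
      (hs_dist2 (step w z) ws + C) / (2 * gamma)))%:E).
    apply: IH => // [|s sn]; first exact: hs_norm_step.
    apply: le_trans (hG (z :: s) _) _; first by rewrite /= sn.
    by rewrite big_ltn // big_add1 /= take0 /= addrA.
  rewrite lee_fin lerD2l ler_wpM2l // lerD2l ler_pM2r ?invr_gt0 // lerD2r.
  exact: hs_dist2_asgd_step.
rewrite /=; apply: le_trans (ge0_le_integral_nonmeasurable P _ Hz) _.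
  by move=> z; apply: iid_expect_ge0.
have isb := integrable_step_bound gamma wD.
have -> : (fun z => (c + kappa * (A + rho w +
      (step_bound gamma w z + C) / (2 * gamma)))%:E)
    = (fun z => (c + kappa * (A + rho w + C / (2 * gamma)) +
         (kappa / (2 * gamma)) * step_bound gamma w z)%:E).
  by apply/funext => z; congr EFin; field; rewrite gt_eqF.
rewrite EFin_Rintegral; last first.
  by apply: integrable_realD; [exact: integrable_real_cst|exact: integrable_realZ].
rewrite meanD ?mean_cst ?meanZ //; [|exact: integrable_real_cst|exact: integrable_realZ].
rewrite lee_fin.
(* In the mean, the term [- 2 * gamma * rho w] cancels the accumulated [rho w], and one more
   [gamma ^+ 2 * M ^+ 2] raises the count to [n.+2]. *)
have := mean_step_bound gamma wD; set m := \int[P]_z _ => hm.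
have kg0 : 0 <= kappa / (2 * gamma) by rewrite divr_ge0 // ltW.
rewrite -lerBrDl; apply: le_trans (ler_wpM2l kg0 hm) _.
rewrite le_eqVlt; apply/orP; left; apply/eqP.
rewrite /C -[n.+2%:R]natr1; field; rewrite gt_eqF //.
Qed.

End Descent.

(** * The averaged output and the final bound *)

Lemma asgd_average_sum (R : realType) (d : measure_display) (X : measurableType d)
    (k r : nat) (V : normedModType R)
    (ip : V -> V -> R) (psi : X -> V) (F : 'M[R]_(k.+1, r))
    (g : 'cV[R]_k.+1 -> 'I_k.+1 -> 'cV[R]_k.+1) (D gamma : R) (N : nat)
    (s : seq (X * 'I_k.+1)) (j : 'I_r) : (0 < N)%N ->
  N%:R *: asgd_average ip psi F g D gamma N s j =
  \sum_(1 <= t < N.+1) asgd_iterate ip psi F g D gamma s t j.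
Proof.
by move=> N0; rewrite /asgd_average scalerA mulfV ?scale1r // pnatr_eq0 -lt0n.
Qed.

Lemma hs_norm_asgd_iterate (R : realType) (d : measure_display) (X : measurableType d)
    (k r : nat) (V : normedModType R)
    (ip : V -> V -> R) (psi : X -> V) (F : 'M[R]_(k.+1, r))
    (g : 'cV[R]_k.+1 -> 'I_k.+1 -> 'cV[R]_k.+1) (D gamma : R)
    (s : seq (X * 'I_k.+1)) (t : nat) :
  0 <= D -> hs_norm (asgd_iterate ip psi F g D gamma s t) <= D.
Proof.
move=> D0; rewrite /asgd_iterate.
have : hs_norm (fun _ : 'I_r => 0 : V) <= D by rewrite hs_norm0.
elim: (take t s) (fun=> 0) => //= z s' IH w wD.
by apply: IH; exact: hs_norm_proj_ball.
Qed.

Theorem theorem6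
  (R : realType) (d : measure_display) (X : measurableType d) (k r : nat)
  (* task loss: nonnegative (k+1) x (k+1) matrix; labels are 'I_k.+1 *)
  (L : 'M[R]_k.+1) (hL : forall i j, 0 <= L i j)
  (F : 'M[R]_(k.+1, r))
  (* RKHS (V, <.,.>) of the positive definite kernel K, with feature map psi *)
  (V : completeNormedModType R) (ip : V -> V -> R) (hip : inner_product ip)
  (K : X -> X -> R) (psi : X -> V)
  (hK : forall x x', K x x' = ip (psi x) (psi x'))
  (hdense : dense_span psi)
  (hKmeas : measurable_fun setT (fun p : X * X => K p.1 p.2))
  (hpsimeas : forall h : V, measurable_fun setT (fun x => ip h (psi x)))
  (* surrogate loss *)
  (Phi : 'cV[R]_k.+1 -> 'I_k.+1 -> R)
  (hPhicont : forall y, continuous (fun f => Phi f y))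
  (hPhiconv : forall y (f1 f2 : 'cV[R]_k.+1) (t : R), 0 <= t <= 1 ->
      Phi (t *: f1 + (1 - t) *: f2) y <= t * Phi f1 y + (1 - t) * Phi f2 y)
  (hPhilb : forall y, exists B : R, forall f, B <= Phi f y)
  (* the (sub)gradient used by the algorithm *)
  (g : 'cV[R]_k.+1 -> 'I_k.+1 -> 'cV[R]_k.+1)
  (hg : forall (f : 'cV[R]_k.+1) y (f' : 'cV[R]_k.+1), Phi f y + \sum_c g f y c 0 * (f' c 0 - f c 0) <= Phi f' y)
  (hgmeas : forall y i, measurable_fun setT
      (fun t : k.+1.-tuple R => g (\col_c tnth t c) y i 0))
  (* data distribution *)
  (P : probability (X * 'I_k.+1)%type R)
  (D M : R) (hD : 0 <= D) (hM : 0 < M)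
  (hopt : exists wstar : 'I_r -> V, [/\ hs_norm wstar <= D,
      meas_score_funs F (fun x => F *m apply_op ip wstar (psi x)) &
      risk_Phi P Phi (fun x => F *m apply_op ip wstar (psi x)) =
      ereal_inf [set risk_Phi P Phi f | f in meas_score_funs F]])
  (hgrad : forall w : 'I_r -> V, hs_norm w <= D ->
      (\int[P]_z ((hs_norm (fun j =>
          (F^T *m g (F *m apply_op ip w (psi z.1)) z.2) j 0 *: psi z.1)) ^+ 2)%:E
       <= (M ^+ 2)%:E)%E)
  (* convex non-decreasing (nonnegative) lower bound of the calibration function *)
  (Hc : R -> R)
  (hHc_nonneg : forall e, 0 <= e -> 0 <= Hc e)
  (hHc_mono : forall e1 e2, 0 <= e1 -> e1 <= e2 -> Hc e1 <= Hc e2)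
  (hHc_conv : forall e1 e2 (t : R), 0 <= e1 -> 0 <= e2 -> 0 <= t <= 1 ->
      Hc (t * e1 + (1 - t) * e2) <= t * Hc e1 + (1 - t) * Hc e2)
  (hHc_lb : forall e, 0 <= e -> ((Hc e)%:E <= calibration_fun Phi L F e)%E) :
  forall (eps : R), 0 < eps ->
  forall N : nat,
    (* N > N* := 4 D^2 M^2 / Hc(eps)^2  (N* = +oo when Hc(eps) = 0) *)
    4 * D ^+ 2 * M ^+ 2 < N%:R * Hc eps ^+ 2 ->
    let gamma := 2 * D / (M * Num.sqrt N%:R) in
    (iid_expect P N (fun s => risk_L P L
        (fun x => F *m apply_op ip (asgd_average ip psi F g D gamma N s) (psi x)))
     < ereal_inf [set risk_L P L f | f in meas_score_funs F] + eps%:E)%E.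
Proof.
move=> eps eps0 N hN; cbv zeta; set gamma := 2 * D / _.
(* The strict inequality on [N] excludes both [N = 0] and [Hc eps = 0]. *)
have NHc0 : 0 < N%:R * Hc eps ^+ 2.
  apply: le_lt_trans hN; apply: mulr_ge0; last exact: sqr_ge0.
  by apply: mulr_ge0 => //; exact: sqr_ge0.
have N0 : (0 < N)%N by case: (N) NHc0; rewrite ?mul0r ?ltxx.
have NR0 : 0 < N%:R :> R by rewrite ltr0n.
have Hc0 : 0 < Hc eps.
  rewrite lt_neqAle hHc_nonneg ?ltW // andbT eq_sym.
  by apply: contraTneq NHc0 => ->; rewrite expr0n mulr0 ltxx.
have [ws [wsD _ ws_opt]] := hopt.
(* With finitely many labels, the lower bounds merge into one. *)
have [B PhiB] : exists B, forall f y, B <= Phi f y.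
  have [b hb] := choice hPhilb; exists (- \sum_y `|b y|) => f y.
  apply: le_trans (hb y f); rewrite lerNl (bigD1 y) //=.
  apply: le_trans (ler_norm _) _; rewrite normrN lerDl.
  by apply: sumr_ge0 => ? _.
(* The squared norm is the kernel on the diagonal. *)
have norm_psi_meas : measurable_fun setT (fun x => `|psi x| ^+ 2).
  have -> : (fun x => `|psi x| ^+ 2) = (fun p : X * X => K p.1 p.2) \o (fun x => (x, x)).
    by apply/funext => x /=; rewrite hK (ip_norm hip).
  by apply: measurableT_comp => //; exact: measurable_fun_pair.
have [a a0 Hc_supp] := convex_nondecreasing_support eps0 hHc_mono hHc_conv.
have m_score := meas_score F hpsimeas.
have meas0 : meas_score_funs F (fun _ : X => 0).
  by split=> [x|i]; [exact: score_set0|exact: measurable_cst].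
(* The optimal risk is at most that of the zero score, which is finite because only finitely many
   values occur. *)
have int_ws : integrable_Phi P Phi (score ip psi F ws).
  apply: (@bounded_below_integrable _ _ _ _ _ B) => [|z|].
  - exact: (measurable_Phi_score F hpsimeas hPhicont).
  - exact: PhiB.
  - move: ws_opt; rewrite /risk_Phi -/(score ip psi F ws) => ->.
    apply: (@le_lt_trans _ _ (risk_Phi P Phi (fun _ : X => 0))).
      by apply: ereal_inf_lbound; exists (fun _ => 0).
    rewrite /risk_Phi EFin_Rintegral ?ltry //.
    apply: (@integrable_real_bounded _ _ _ _ _ B (\sum_y `|Phi 0 y|)).
      exact: (measurable_fun_surr_loss hPhicont meas0.2).
    move=> z; rewrite PhiB /= (bigD1 z.2) //=.
    apply: le_trans (ler_norm _) _; rewrite lerDl.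
    by apply: sumr_ge0 => ? _.
have opt_le u : meas_score_funs F u -> integrable_Phi P Phi u ->
    mean_Phi P Phi (score ip psi F ws) <= mean_Phi P Phi u.
  move=> mu iu; rewrite -lee_fin /mean_Phi -!EFin_Rintegral //.
  move: ws_opt; rewrite /risk_Phi -/(score ip psi F ws) => ->.
  by apply: ereal_inf_lbound; exists u.
have transfer f h := @excess_transfer _ _ _ _ _ P L F Phi hL hPhicont Hc eps a B _
  PhiB eps0 a0 (ltW Hc0) Hc_supp hHc_lb opt_le f h.
(* Comparing [ws] with itself gives [Hc eps <= a * eps], so the slope cannot vanish. *)
have a_gt0 : 0 < a.
  have := transfer _ _ (m_score ws) (m_score ws) int_ws => h.
  have : Hc eps <= a * eps by lra.
  by move=> /(lt_le_trans Hc0); rewrite pmulr_lgt0.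
have [||RL [RL_eq _ RL_adh]] := @ereal_inf_image _ _ (meas_score_funs F)
    (fun f : X -> _ => mean_L P L f) 0.
- by exists (fun=> 0).
- by move=> f _; exact: mean_L_ge0.
have -> : ereal_inf [set risk_L P L f | f in meas_score_funs F] = RL%:E.
  rewrite -RL_eq; congr ereal_inf; apply: eq_imagel => f mf.
  exact: (risk_L_mean P hL mf).
have excess f : meas_score_funs F f -> integrable_Phi P Phi f ->
    mean_L P L f <= RL + eps - Hc eps / a +
      a^-1 * (mean_Phi P Phi f - mean_Phi P Phi (score ip psi F ws)).
  move=> mf intf; rewrite -(ler_pM2l a_gt0).
  have -> : a * (RL + eps - Hc eps / a + a^-1 *
      (mean_Phi P Phi f - mean_Phi P Phi (score ip psi F ws))) =
      a * RL + a * eps - Hc eps + mean_Phi P Phi f - mean_Phi P Phi (score ip psi F ws).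
    by field; rewrite gt_eqF.
  apply/ler_addgt0Pr => e e0.
  have [h mh hlt] := RL_adh (e / a) (divr_gt0 e0 a_gt0).
  have := transfer f h mf mh intf.
  move: hlt; rewrite -(ltr_pM2l a_gt0) mulrDr [a * (e / a)]mulrC divfK ?gt_eqF //.
  by lra.
have risk0 s : (0 <= risk_L P L (fun x =>
    F *m apply_op ip (asgd_average ip psi F g D gamma N s) (psi x)))%E.
  by apply: integral_ge0 => z _; rewrite lee_fin.
(* For [D = 0] the step size is zero and the regret bound cannot be divided by it; but then [ws] and
   every iterate are zero, so the output is the optimal score. *)
have [D_gt0|D_le0] := ltP 0 D; last first.
  have zero (w : 'I_r -> V) : hs_norm w <= D -> forall j, w j = 0.
    by move=> wD; apply: hs_norm_le0; exact: le_trans D_le0.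
  apply: (@le_lt_trans _ _ (mean_L P L (score ip psi F ws))%:E).
    apply: iid_expect_le_cst => // s _.
    have -> : (fun x => F *m apply_op ip (asgd_average ip psi F g D gamma N s) (psi x)) =
        score ip psi F ws.
      apply/funext => x; congr (_ *m _); apply/matrixP => i j; rewrite !mxE.
      congr ip; rewrite (zero ws wsD) /asgd_average big1 ?scaler0 // => t _.
      by apply: zero; exact: hs_norm_asgd_iterate.
    by rewrite (risk_L_mean P hL (m_score ws)).
  rewrite -EFinD lte_fin; apply: le_lt_trans (excess _ (m_score ws) int_ws) _.
  by rewrite subrr mulr0 addr0 ltrBlDr ltrDl divr_gt0.
have sN0 : 0 < Num.sqrt (N%:R : R) by rewrite sqrtr_gt0.
have gamma0 : 0 < gamma by rewrite /gamma divr_gt0 ?mulr_gt0.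
have int_score := integrable_Phi_score hip norm_psi_meas hpsimeas hPhicont PhiB
  hg hgmeas hgrad int_ws.
pose rho w := mean_Phi P Phi (score ip psi F w) - mean_Phi P Phi (score ip psi F ws).
(* The factor [1/a] comes from the excess transfer, [1/N] from averaging. *)
pose kappa := (a * N%:R)^-1.
have kappa0 : 0 < kappa by rewrite invr_gt0 mulr_gt0.
pose c := RL + eps - Hc eps / a.
pose iterate s t := asgd_iterate ip psi F g D gamma s t.
have risk_le s : size s = N -> (risk_L P L (fun x =>
    F *m apply_op ip (asgd_average ip psi F g D gamma N s) (psi x)) <=
    (c + kappa * \sum_(1 <= t < N.+1) rho (iterate s t))%:E)%E.
  move=> _; set wb := asgd_average _ _ _ _ _ _ _ _.
  have itD t : hs_norm (iterate s t) <= D by exact: hs_norm_asgd_iterate.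
  have sizeN : size (index_iota 1 N.+1) = N by rewrite size_iota subSS subn0.
  have avg z : N%:R * Phi (score ip psi F wb z.1) z.2 <=
      \sum_(1 <= t < N.+1) Phi (score ip psi F (iterate s t) z.1) z.2.
    rewrite -{1}sizeN; apply: (surr_loss_average hip psi F hg) => j.
    by rewrite sizeN asgd_average_sum.
  have int_it t : integrable_real P (fun z => Phi (score ip psi F (iterate s t) z.1) z.2).
    exact: int_score.
  (* The loss of the average lies between [B] and the mean loss of the iterates. *)
  have int_wb : integrable_Phi P Phi (score ip psi F wb).
    apply: (@integrable_real_sandwich _ _ _ _ (fun=> B) (fun z =>
      N%:R^-1 * \sum_(1 <= t < N.+1) Phi (score ip psi F (iterate s t) z.1) z.2)).
    - exact: (measurable_Phi_score F hpsimeas hPhicont).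
    - exact: integrable_real_cst.
    - by apply: integrable_realZ; exact: integrable_real_sum.
    - by move=> z; rewrite PhiB /= ler_pdivlMl.
  rewrite (risk_L_mean P hL (m_score wb)) lee_fin.
  apply: le_trans (excess _ (m_score wb) int_wb) _; rewrite lerD2l.
  rewrite /kappa invfM -mulrA ler_pM2l ?invr_gt0 // ler_pdivlMl //.
  rewrite /rho sumrB big_const_nat subSS subn0 iter_addr_0 mulrBr !mulr_natl lerD2r.
  rewrite -mulr_natl -meanZ // -mean_sum //.
  by apply: le_mean => //; [exact: integrable_realZ|exact: integrable_real_sum].
case: N => [//|n] in hN gamma NHc0 N0 NR0 risk0 sN0 gamma0 kappa kappa0 iterate risk_le *.
pose bound := c + kappa * ((4 * D ^+ 2 + n.+1%:R * (gamma ^+ 2 * M ^+ 2)) / (2 * gamma)).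
apply: (@le_lt_trans _ _ bound%:E).
  (* The first sample only produces [w], the first averaged iterate; its squared distance to [ws] is
     bounded uniformly by [4 * D ^+ 2], and the regret lemma handles the other [n] samples. *)
  apply: integral_le_cst => z; first exact: iid_expect_ge0.
  set w := asgd_step ip psi F g D gamma (fun=> 0) z.
  have wD : hs_norm w <= D by exact: hs_norm_proj_ball.
  have := iid_expect_regret hip norm_psi_meas hpsimeas hPhicont PhiB hg hgmeas D_gt0
    hgrad wsD int_ws gamma0 (c := c) (kappa := kappa) (n := n) (w := w) (A := 0)
    (G := fun s => risk_L P L (fun x =>
      F *m apply_op ip (asgd_average ip psi F g D gamma n.+1 (z :: s)) (psi x))).
  move=> /(_ (ltW kappa0) wD (fun s => risk0 (z :: s))) h.
  apply: le_trans (h _) _ => [s sn|].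
    apply: le_trans (risk_le (z :: s) _) _; first by rewrite /= sn.
    by rewrite big_ltn // big_add1 /= add0r /iterate /asgd_iterate /= take0.
  rewrite lee_fin /bound lerD2l ler_pM2l // add0r ler_pM2r ?invr_gt0 ?(mulr_gt0 _ gamma0) //.
  by rewrite lerD2r; exact: (hs_dist2_ball hip wD wsD).
rewrite -EFinD lte_fin /bound /c.
have sqN : n.+1%:R = Num.sqrt (n.+1%:R : R) ^+ 2 by rewrite sqr_sqrtr.
(* The choice of [gamma] makes both terms equal to [D * M * Num.sqrt n.+1%:R]. *)
have -> : (4 * D ^+ 2 + n.+1%:R * (gamma ^+ 2 * M ^+ 2)) / (2 * gamma) =
    2 * D * M * Num.sqrt n.+1%:R.
  rewrite /gamma {1}sqN; field.
  by rewrite !gt_eqF.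
suff : kappa * (2 * D * M * Num.sqrt n.+1%:R) < Hc eps / a by lra.
have -> : kappa * (2 * D * M * Num.sqrt n.+1%:R) = 2 * D * M / Num.sqrt n.+1%:R / a.
  rewrite /kappa {1}sqN; field.
  by rewrite !gt_eqF.
(* Were [Hc eps * Num.sqrt n.+1%:R] at most [2 * D * M], squaring would contradict [hN]. *)
rewrite ltr_pM2r ?invr_gt0 // ltr_pdivrMr // ltNge; apply/negP => h.
have Hs0 : 0 <= Hc eps * Num.sqrt (n.+1%:R : R) by rewrite mulr_ge0 ?ltW.
have := ler_pM Hs0 Hs0 h h; rewrite -!expr2 !exprMn -sqN => h2.
by move: hN; rewrite ltNge => /negP; apply; lra.
Qed.
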